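(* Let $(X,\mu_X)$ and $(\mathcal{M},\mu_{\mathcal{M}})$ be $\sigma$-finite measure spaces, and let $\mathcal{D}=(g_s)_{s\in\mathcal{M}}\subseteq L^\infty(X)$ be a Parseval determining set for $L^1(X)$. Let $\mathcal{H}$ be a separable Hilbert space, $(\mathcal{N},\mu_{\mathcal{N}})$ another $\sigma$-finite measure space, and $\mathscr{A}=(\varphi_t)_{t\in\mathcal{N}}\subseteq L^2(X;\mathcal{H})$ a jointly measurable family. Let $\mathscr{A}_0\subseteq\mathscr{A}$ be a countable dense subset, and define for a.e. $x\in X$ $$J(x)=\overline{\operatorname{span}}\{\varphi(x):\varphi\in\mathscr{A}_0\}\subseteq\mathcal{H}.$$ For constants $0<A\le B<\infty$, the following are equivalent: (i) $E_{\mathcal{D}}(\mathscr{A})=\{g_s\varphi_t : s\in\mathcal{M},t\in\mathcal{N}\}$ forms a continuous frame for $S_{\mathcal{D}}(\mathscr{A})$ over $\mathcal{M}\times\mathcal{N}$ with bounds $A,B$. That is, $$A\int_X\|\psi(x)\|^2d\mu_X(x)\le\int_{\mathcal{N}}\int_{\mathcal{M}}\left|\int_X\langle\psi(x),g_s(x)\varphi_t(x)\rangle\,d\mu_X(x)\right|^2d\mu_{\mathcal{M}}(s)\,d\mu_{\mathcal{N}}(t)\le B\int_X\|\psi(x)\|^2d\mu_X(x)$$ for all $\psi\in S_{\mathcal{D}}(\mathscr{A})$. (ii) For a.e. $x\in X$ and every $u\in J(x)$, $$A\|u\|^2\le\int_{\mathcal{N}}|\langle u,\varphi_t(x)\rangle|^2\,d\mu_{\mathcal{N}}(t)\le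 B\|u\|^2 .$$
   Context: A Parseval determining set for $L^1(X)$ consists of a measure space $(\mathcal{M},\mu_{\mathcal{M}})$ and a family $(g_t)_{t\in\mathcal{M}}\subseteq L^\infty(X)$ such that for each $f\in L^1(X)$ the map $t\mapsto\int_Xf(x)\overline{g_t(x)}\,d\mu_X(x)$ is measurable on $\mathcal{M}$ and $$\int_{\mathcal{M}}\left|\int_Xf(x)\overline{g_t(x)}\,d\mu_X(x)\right|^2d\mu_{\mathcal{M}}(t)=\int_X|f(x)|^2\,d\mu_X(x),$$ where both sides may be infinite. A family $(\varphi_t)_{t\in\mathcal{N}}\subseteq L^2(X;\mathcal{H})$ is jointly measurable if there is a function $\Phi\colon\mathcal{N}\times X\to\mathcal{H}$ such that (1) for a.e. $t\in\mathcal{N}$, $\Phi(t,\cdot)=\varphi_t$ a.e. on $X$, and (2) for every $u\in\mathcal{H}$ the function $(t,x)\mapsto\langle\Phi(t,x),u\rangle$ is measurable on $\mathcal{N}\times X$. Expressions $\varphi_t(x)$ integrated over $\mathcal N$ are understood as $\Phi(t,x)$ for a fixed such $\Phi$. $(g\varphi)(x)=g(x)\varphi(x)$, and $S_{\mathcal{D}}(\mathscr{A})=\overline{\operatorname{span}}\{g\varphi : g\in\mathcal{D},\varphi\in\mathscr{A}\}\subseteq L^2(X;\mathcal{H})$. A family $(u_t)_{t\in\mathcal{P}}$ in a Hilbert space $\mathcal{K}$, indexed by a measure space $\mathcal{P}$, is a continuous frame for $\mathcal{K}$ with bounds $A,B$ if $t\mapsto\langle v,u_t\rangle$ is measurable and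 $A\|v\|^2\le\int_{\mathcal{P}}|\langle v,u_t\rangle|^2dt\le B\|v\|^2$ for every $v\in\mathcal{K}$. *)

(* Defs.v *)
From mathcomp Require Import all_boot all_order all_algebra.
From mathcomp Require Import all_classical all_reals all_analysis.
From mathcomp Require Import complex.

Set Implicit Arguments.
Unset Strict Implicit.
Unset Printing Implicit Defensive.

Import Order.TTheory GRing.Theory Num.Theory.
Import numFieldNormedType.Exports.

Local Open Scope classical_set_scope.
Local Open Scope ring_scope.

Notation normc := ComplexField.Normc.normc.

Definition span (K : pzRingType) (V : lmodType K) (A : set V) : set V :=
  [set v | exists n (c : 'I_n -> K) (a : 'I_n -> V),
     (forall i, A (a i)) /\ v = \sum_(i < n) c i *: a i].

Definition separable (T : topologicalType) : Prop :=
  exists2 D : set T, countable D & dense D.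

(* The norm of a normed module over R[i] takes its values in R[i]; `hnorm` is
   the same norm as an element of R. *)
Definition hnorm (R : realType) (H : normedModType R[i]) (u : H) : R :=
  complex.Re `|u|.

(* An inner product is linear in its first argument and conjugate-linear in the
   second; with this compatibility a complete normed module over R[i] is a
   complex Hilbert space. *)
Definition norm_induced_by (R : realType) (H : normedModType R[i])
    (ip : {dot H for Num.conj}) : Prop :=
  forall u : H, `|u| ^+ 2 = ip u u.

Section ComplexIntegration.
Context (d : measure_display) (T : measurableType d) (R : realType).
Variable mu : {measure set T -> \bar R}.

Definition measurable_complex (f : T -> R[i]) : Prop :=
  measurable_fun [set: T] (fun x => complex.Re (f x)) /\
  measurable_fun [set: T] (fun x => complex.Im (f x)).

Definition ae_measurable_complex (f : T -> R[i]) : Prop :=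
  exists2 h : T -> R[i], measurable_complex h & \forall x \ae mu, f x = h x.

Definition cintegral (f : T -> R[i]) : R[i] :=
  Complex (\int[mu]_x complex.Re (f x)) (\int[mu]_x complex.Im (f x)).

Definition complex_Lp (p : \bar R) : set (T -> R[i]) :=
  [set f | measurable_complex f /\
           (Lnorm mu p (fun x => (normc (f x))%:E) < +oo)%E].

End ComplexIntegration.

Section VectorValuedL2.
Context (d : measure_display) (X : measurableType d) (R : realType).
Variables (mu : {measure set X -> \bar R}) (H : normedModType R[i]).
Variable ip : {dot H for Num.conj}.

Definition L2norm (f : X -> H) : \bar R :=
  Lnorm mu 2%:E (fun x => (hnorm (f x))%:E).

(* For separable H, weak measurability coincides with Borel and with strong
   measurability (Pettis). *)
Definition vector_L2 : set (X -> H) :=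
  [set f | (forall u : H, measurable_complex (fun x => ip (f x) u)) /\
           (L2norm f < +oo)%E].

Definition L2inner (f h : X -> H) : R[i] :=
  cintegral mu (fun x => ip (f x) (h x)).

Definition L2closure (F : set (X -> H)) : set (X -> H) :=
  [set f | vector_L2 f /\
     forall e : R, 0 < e -> exists2 h, F h & (L2norm (f \- h)%R < e%:E)%E].

Definition modulations (D : set (X -> R[i])) (F : set (X -> H)) :
    set (X -> H) :=
  [set h | exists2 g, D g & exists2 f, F f & h = (fun x => g x *: f x)].

Definition S_ (D : set (X -> R[i])) (F : set (X -> H)) : set (X -> H) :=
  L2closure (span (modulations D F)).

Definition fibre_space (F : set (X -> H)) (x : X) : set H :=
  closure (span [set f x | f in F]).

End VectorValuedL2.

Definition parseval_determining (dX dM : measure_display)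
    (X : measurableType dX) (M : measurableType dM) (R : realType)
    (muX : {measure set X -> \bar R}) (muM : {measure set M -> \bar R})
    (g : M -> X -> R[i]) : Prop :=
  (forall s, complex_Lp muX +oo%E (g s)) /\
  forall f : X -> R[i], complex_Lp muX 1%E f ->
    let coef s := cintegral muX (fun x => f x * Num.conj (g s x)) in
    measurable_complex coef /\
    (\int[muM]_s ((normc (coef s)) ^+ 2)%:E =
     \int[muX]_x ((normc (f x)) ^+ 2)%:E)%E.

Definition joint_representative (dN dX : measure_display)
    (N : measurableType dN) (X : measurableType dX) (R : realType)
    (muN : {measure set N -> \bar R}) (muX : {measure set X -> \bar R})
    (H : normedModType R[i]) (ip : {dot H for Num.conj})
    (phi Phi : N -> X -> H) : Prop :=
  (\forall t \ae muN, \forall x \ae muX, Phi t x = phi t x) /\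
  forall u : H, measurable_complex (fun p : N * X => ip (Phi p.1 p.2) u).

(* K is a space of representatives, with the squared norm of v equal to
   inner v v.  Since families of vectors are only determined up to null sets of
   indices (`joint_representative`), measurability of the coefficients is
   required up to modification on a null set. *)
Definition continuous_frame (dP : measure_display) (P : measurableType dP)
    (R : realType) (mu : {measure set P -> \bar R}) (V : Type) (K : set V)
    (inner : V -> V -> R[i]) (A B : R) (u : P -> V) : Prop :=
  (forall p, K (u p)) /\
  forall v, K v ->
    let energy := (\int[mu]_p ((normc (inner v (u p))) ^+ 2)%:E)%E
    in [/\ ae_measurable_complex mu (fun p => inner v (u p)),
           ((A * complex.Re (inner v v))%:E <= energy)%E &
           (energy <= (B * complex.Re (inner v v))%:E)%E].

(* Main.v *)
Require Import Defs.
From mathcomp Require Import all_boot all_order all_algebra.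
From mathcomp Require Import all_classical all_reals all_analysis.
From mathcomp Require Import measurable_realfun ess_sup_inf.
From mathcomp Require Import complex ring lra.
From mathcomp Require finmap.

(** Let [G x u] be the integral over [N] of [|<u, Phi t x>|^2], the energy of [u]
    in the fibre over [x].  For [psi] in L2, the integral of [<psi, g s *: Phi t>]
    is the coefficient at [s] of the function [<psi, Phi t>], which is in L1 for
    almost every [t].  The Parseval identity and Tonelli's theorem turn the
    double integral of the squared coefficients into the integral over [X] of
    [G x (psi x)] ([iterated_energy]).  So the frame inequality on the space [S_]
    is an integrated form of the inequality in the fibres, and the theorem says
    that it can be localized.

    From the fibres to [S_]: an element [psi] of [S_] is an L2 limit of functions
    with values in the fibre spaces, hence has almost all its values there
    ([S_fibre]), and the inequality can be integrated ([global_of_fibre]).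

    From [S_] to the fibres: [S_] contains all combinations of the [phi t] with
    bounded measurable coefficients ([bounded_combination_S]), in particular the
    products of indicators of measurable sets with elements of the span of [A0].
    To see this, let [rho n] be the residuals of a sequence in the span of the
    modulations that minimizes the distance to such a combination.  They become
    orthogonal to all [g s *: phi t]; and [<rho n, phi t>] converges in L1, to a
    function whose coefficients vanish and which is therefore zero.  So the
    residuals become orthogonal to the combination itself, and the distance is
    zero.  Localizing on all measurable sets gives the fibre inequality almost
    everywhere for each rational combination of elements of [A0]
    ([fibre_of_global_combination]).  These are countably many and are dense in
    the fibre spaces, to which the inequality extends by Fatou's lemma
    ([frame_inequality_closure]).

    The continuous frame condition moreover requires the coefficients to be
    almost everywhere equal to a measurable function on [M * N], while [g] is
    only measurable in [s] through its pairings with functions of [x].  A Dynkin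
    argument on [N * X] provides this ([measurable_pairing]); Tonelli's theorem
    on [M * N] then identifies the energy over the product with the iterated
    integral ([product_energy]). *)

Set Implicit Arguments.
Unset Strict Implicit.
Unset Printing Implicit Defensive.

Import Order.TTheory GRing.Theory Num.Theory.
Import numFieldNormedType.Exports.

Local Open Scope classical_set_scope.
Local Open Scope ring_scope.

Local Notation Re := complex.Re.
Local Notation Im := complex.Im.
Local Notation span := Defs.span.

(** * Complex scalars and Hilbert space algebra *)

Section ComplexScalars.
Variable R : realType.
Implicit Types z w : R[i].

Lemma conjCE z : Num.conj z = Complex (Re z) (- Im z).
Proof. by have -> : Num.conj z = conjc z by []; case: z. Qed.

Lemma mulCE z w : z * w = Complex (Re z * Re w - Im z * Im w) (Re z * Im w + Im z * Re w).
Proof. by case: z; case: w. Qed.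

Lemma addCE z w : z + w = Complex (Re z + Re w) (Im z + Im w).
Proof. by case: z; case: w. Qed.

Lemma oppCE z : - z = Complex (- Re z) (- Im z).
Proof. by case: z. Qed.

Lemma normc_ge0 z : 0 <= normc z.
Proof. by case: z => a b /=; apply: sqrtr_ge0. Qed.

Lemma normc2E z : normc z ^+ 2 = Re z ^+ 2 + Im z ^+ 2.
Proof. by case: z => a b /=; rewrite sqr_sqrtr// addr_ge0// sqr_ge0. Qed.

Lemma normCE z : `|z| = (normc z)%:C%C.
Proof. by case: z. Qed.

Lemma ler_Re_normc z : `|Re z| <= normc z.
Proof.
by rewrite -(@ler_pXn2r _ 2)// ?nnegrE ?normc_ge0// real_normK ?num_real// normc2E lerDl sqr_ge0.
Qed.
Lemma ler_Im_normc z : `|Im z| <= normc z.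
Proof.
by rewrite -(@ler_pXn2r _ 2)// ?nnegrE ?normc_ge0// real_normK ?num_real// normc2E lerDr sqr_ge0.
Qed.

End ComplexScalars.

Section Hilbert.
Variables (R : realType) (H : normedModType R[i]) (ip : {dot H for Num.conj}).
Hypothesis hip : norm_induced_by ip.
Implicit Types (u v w : H) (c : R[i]).

Lemma normHE u : `|u| = (hnorm u)%:C%C.
Proof.
by rewrite /hnorm; have := normr_ge0 u; case: `|u| => a b; rewrite lecE/= => /andP[/eqP-> _].
Qed.

Lemma hnorm_ge0 u : 0 <= hnorm u.
Proof. by have := normr_ge0 u; rewrite normHE lecR. Qed.

Lemma hnormN u : hnorm (- u) = hnorm u.
Proof. by rewrite /hnorm normrN. Qed.

Lemma hnorm0 : hnorm (0 : H) = 0.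
Proof. by rewrite /hnorm normr0. Qed.

Lemma hnormZ c u : hnorm (c *: u) = normc c * hnorm u.
Proof. by rewrite {1}/hnorm normrZ normCE normHE mulCE/= mul0r subr0. Qed.

Lemma ler_hnormD u v : hnorm (u + v) <= hnorm u + hnorm v.
Proof. by have := ler_normD u v; rewrite !normHE lecE addCE/= => /andP[]. Qed.

Lemma ip_addl u v w : ip (u + v) w = ip u w + ip v w. Proof. exact: linearDl. Qed.
Lemma ip_addr u v w : ip w (u + v) = ip w u + ip w v. Proof. exact: linearDr. Qed.
Lemma ip_subl u v w : ip (u - v) w = ip u w - ip v w. Proof. exact: linearBl. Qed.
Lemma ip_scalel c u v : ip (c *: u) v = c * ip u v. Proof. exact: linearZl_LR. Qed.
Lemma ip_scaler c u v : ip u (c *: v) = Num.conj c * ip u v. Proof. exact: linearZr_LR. Qed.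
Lemma ipC u v : ip u v = Num.conj (ip v u). Proof. by rewrite hermC expr0 mul1r. Qed.

Lemma ip_hnorm u : ip u u = (hnorm u ^+ 2)%:C%C.
Proof. by rewrite -hip normHE -rmorphXn. Qed.

(** The underlying real inner product: estimates are proved for it and carried
    over to imaginary parts by [Im_ip]. *)
Definition rip u v := Re (ip u v).

Lemma ripC u v : rip u v = rip v u.
Proof. by rewrite /rip ipC conjCE. Qed.
Lemma rip_subl u v w : rip (u - v) w = rip u w - rip v w.
Proof. by rewrite /rip ip_subl addCE oppCE. Qed.
Lemma Im_ip u v : Im (ip u v) = rip u (Complex 0 1 *: v).
Proof. by rewrite /rip ip_scaler conjCE mulCE/=; ring. Qed.

Lemma sqr_hnormD u v : hnorm (u + v) ^+ 2 = hnorm u ^+ 2 + 2 * rip u v + hnorm v ^+ 2.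
Proof.
apply: (@complexI R); rewrite -ip_hnorm ip_addl !ip_addr !ip_hnorm (ipC v u) conjCE /rip.
by rewrite !addCE/=; congr Complex => /=; ring.
Qed.

Lemma sqr_hnormB u v : hnorm (u - v) ^+ 2 = hnorm u ^+ 2 - 2 * rip u v + hnorm v ^+ 2.
Proof.
rewrite sqr_hnormD hnormN /rip -scaleN1r ip_scaler conjCE mulCE oppCE/=; ring.
Qed.

Lemma cauchy_schwarz u v : normc (ip u v) <= hnorm u * hnorm v.
Proof.
rewrite -(@ler_pXn2r _ 2)// ?nnegrE ?normc_ge0 ?mulr_ge0 ?hnorm_ge0//.
have [v0|v0] := eqVneq (hnorm v) 0.
  have -> : v = 0 by apply/eqP; rewrite -normr_eq0 normHE v0.
  by rewrite linear0r hnorm0 mulr0 expr0n normc2E/= expr0n addr0.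
have hv : 0 < hnorm v ^+ 2 by rewrite exprn_gt0// lt0r v0 hnorm_ge0.
(* t z is the coefficient of the orthogonal projection of u on v. *)
set z := ip u v; set t := (hnorm v ^+ 2)^-1.
have := sqr_ge0 (hnorm (u - (t%:C%C * z) *: v)).
rewrite sqr_hnormB hnormZ exprMn normc2E /rip ip_scaler conjCE !mulCE/= -/z.
have -> : 2 * ((t * Re z - 0 * Im z) * Re z - - (t * Im z + 0 * Re z) * Im z) =
  2 * (t * normc z ^+ 2) by rewrite normc2E; ring.
have -> : ((t * Re z - 0 * Im z) ^+ 2 + (t * Im z + 0 * Re z) ^+ 2) * hnorm v ^+ 2 =
  t * normc z ^+ 2 by rewrite normc2E /t; field; exact: v0.
rewrite /t => h; rewrite exprMn -ler_pdivrMr//; lra.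
Qed.
End Hilbert.

(** * Integrals and null sets *)

Section AlmostEverywhere.
Context (d : measure_display) (T : measurableType d) (R : realType).
Variable mu : {measure set T -> \bar R}.
Local Open Scope ereal_scope.
Import HBNNSimple.

(** The integral of a nonnegative function is the supremum of the integrals of
    the simple functions below it.  Such a simple function, cut off on the null
    set where [f] and [h] differ, keeps its integral and lies below [h]. *)
Lemma ae_le_nnintegral (f h : T -> \bar R) : (forall x, 0 <= f x) ->
  (forall x, 0 <= h x) -> (\forall x \ae mu, f x = h x) ->
  \int[mu]_x f x <= \int[mu]_x h x.
Proof.
move=> f0 h0 [N [mN muN fhN]].
rewrite ge0_integralTE// ge0_integralTE//; apply: ge_ereal_sup => _ /= [s sf <-].
apply: ereal_sup_ubound; exists (proj_nnsfun s (measurableC mN)) => [x|].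
  rewrite -mrestrict /= patchE; have [xN|xN] := boolP (x \in ~` N).
    suff <- : f x = h x by exact: sf.
    by apply: contrapT => fh; move: xN; rewrite inE; apply; apply: fhN.
  by [].
rewrite -!integralT_nnsfun [RHS](ge0_negligible_integral _ _ _ _ muN)//; last 2 first.
  - exact/measurable_EFinP.
  - by move=> x _; rewrite lee_fin.
rewrite setTD [RHS]integral_mkcond; apply: eq_integral => x _.
by rewrite -mrestrict !patchE; case: ifPn.
Qed.

(** Iterated integrals below are altered on null sets of the outer variable,
    where the inner integrals need not depend measurably on it. *)
Lemma ae_eq_integralT (f h : T -> \bar R) : (\forall x \ae mu, f x = h x) ->
  \int[mu]_x f x = \int[mu]_x h x.
Proof.
move=> fh; have hf : \forall x \ae mu, h x = f x by apply: filterS fh => x ->.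
have le_int f1 f2 : (\forall x \ae mu, f1 x = f2 x) ->
    (\int[mu]_x f1^\+ x <= \int[mu]_x f2^\+ x) /\
    (\int[mu]_x f1^\- x <= \int[mu]_x f2^\- x).
  move=> f12; split; apply: ae_le_nnintegral => //;
    by apply: filterS f12 => x f12x; rewrite ?funeposE ?funenegE f12x.
have [p1 n1] := le_int _ _ fh; have [p2 n2] := le_int _ _ hf.
by rewrite integralE [RHS]integralE; congr (_ - _); apply/eqP; rewrite eq_le ?p1 ?n1.
Qed.

(** On the set where [h < f] the integral of [f - h] is nonpositive, so this set
    is null.  Finiteness of the integral of [f] is what allows the subtraction. *)
Lemma ae_le_of_integral_le (f h : T -> \bar R) :
  measurable_fun setT f -> measurable_fun setT h ->
  (forall x, 0 <= f x) -> (forall x, 0 <= h x) ->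
  \int[mu]_x f x < +oo ->
  (forall E, measurable E -> \int[mu]_(x in E) f x <= \int[mu]_(x in E) h x) ->
  \forall x \ae mu, f x <= h x.
Proof.
move=> mf mh f0 h0 fi le_fh.
pose E := [set x | h x < f x].
have mE : measurable E.
  by rewrite -[E]setTI; exact: measurable_lte.
have hE x : E x -> h x \is a fin_num.
  by move=> hf; rewrite ge0_fin_numE// (lt_le_trans hf) ?leey.
have fE : \int[mu]_(x in E) f x = \int[mu]_(x in E) h x + \int[mu]_(x in E) (f x - h x).
  rewrite -ge0_integralD//.
  - by apply: eq_integral => x /[!inE] Ex; rewrite addeC subeK// hE.
  - exact: measurable_funTS.
  - by move=> x hf; rewrite sube_ge0 ?(ltW hf)// hE.
  - by apply: emeasurable_funB; exact: measurable_funTS.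
have fEfin : \int[mu]_(x in E) f x \is a fin_num.
  rewrite ge0_fin_numE; last exact: integral_ge0.
  by apply: le_lt_trans fi; exact: ge0_subset_integral.
have hEfin : \int[mu]_(x in E) h x \is a fin_num.
  rewrite ge0_fin_numE; last exact: integral_ge0.
  apply: le_lt_trans (_ : \int[mu]_(x in E) f x < +oo); last first.
    by rewrite -ge0_fin_numE// integral_ge0.
  by apply: ge0_le_integral => //; [exact: measurable_funTS|exact: measurable_funTS|move=> x /ltW].
have mfh : measurable_fun E (f \- h) by apply: emeasurable_funB; exact: measurable_funTS.
have I0 : \int[mu]_(x in E) `|(f \- h) x| = 0.
  rewrite (eq_integral (f \- h)); last first.
    by move=> x /[!inE] Ex; rewrite gee0_abs// sube_ge0 ?(ltW Ex)// hE.
  apply/eqP; rewrite eq_le; apply/andP; split; last first.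
    by apply: integral_ge0 => x hf; rewrite sube_ge0 ?(ltW hf)// hE.
  by have := le_fh _ mE; rewrite fE -[leRHS]adde0 leeD2lE.
move/(ae_eq_integral_abs mu mE mfh) : I0; apply: filterS => x /= fh0.
rewrite leNgt; apply/negP => Ex; have := fh0 Ex.
by move: Ex; rewrite -sube_gt0 => Ex fh; rewrite fh ltxx in Ex.

Qed.
End AlmostEverywhere.

Section NullSections.
Context (d1 d2 : measure_display) (T1 : measurableType d1) (T2 : measurableType d2).
Context (R : realType).
Variables (m1 : {sigma_finite_measure set T1 -> \bar R}).
Variables (m2 : {sigma_finite_measure set T2 -> \bar R}).
Local Open Scope ereal_scope.

Lemma ae_ysection (P : T1 * T2 -> Prop) : (\forall p \ae (m1 \x m2), P p) ->
  \forall t \ae m2, \forall s \ae m1, P (s, t).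
Proof.
move=> [E [mE E0 PE]].
have : \int[m2]_t `|m1 (ysection E t)| = 0.
  rewrite -E0 -[in RHS](setIT E) -integral_indic// fubini_tonelli2//; last first.
    by apply/measurable_EFinP; exact: measurable_indic.
  apply: eq_integral => t _; rewrite gee0_abs// indic_fubini_tonelli_GE//.
move/(ae_eq_integral_abs m2 measurableT (measurable_fun_ysection m1 mE)).
apply: filterS => t /= /(_ I) E0t; exists (ysection E t); split => //.
  exact: measurable_ysection.
move=> s /= nP; rewrite /ysection/= inE; exact: PE.
Qed.
End NullSections.

(** * Measurability of complex and of vector-valued functions *)

Section MeasurableComplex.
Context (d : measure_display) (T : measurableType d) (R : realType).
Implicit Types f h : T -> R[i].

Lemma measurable_complex_cst (c : R[i]) : measurable_complex (fun _ : T => c).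
Proof. by split; exact: measurable_cst. Qed.

Lemma measurable_complexD f h : measurable_complex f -> measurable_complex h ->
  measurable_complex (fun x => f x + h x).
Proof.
move=> [f1 f2] [h1 h2]; split; under eq_fun do rewrite addCE/=; exact: measurable_funD.
Qed.

Lemma measurable_complexM f h : measurable_complex f -> measurable_complex h ->
  measurable_complex (fun x => f x * h x).
Proof.
move=> [f1 f2] [h1 h2]; split; under eq_fun do rewrite mulCE/=.
  by apply: measurable_funB; exact: measurable_funM.
by apply: measurable_funD; exact: measurable_funM.
Qed.

Lemma measurable_complex_conj f : measurable_complex f ->
  measurable_complex (fun x => Num.conj (f x)).
Proof.
move=> [f1 f2]; split; under eq_fun do rewrite conjCE/=; first by [].
exact: measurable_funN.
Qed.

Lemma measurable_sqr_normc f : measurable_complex f ->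
  measurable_fun setT (fun x => normc (f x) ^+ 2).
Proof.
move=> [f1 f2]; under eq_fun do rewrite normc2E.
by apply: measurable_funD; exact: measurable_funX.
Qed.

Lemma measurable_complex_comp (d' : measure_display) (T' : measurableType d')
    (k : T' -> T) f : measurable_fun setT k -> measurable_complex f ->
  measurable_complex (fun x => f (k x)).
Proof.
move=> mk [f1 f2].
by split; [exact: (measurableT_comp f1 mk)|exact: (measurableT_comp f2 mk)].
Qed.

End MeasurableComplex.

Section WeakMeasurability.
Context (d : measure_display) (T : measurableType d) (R : realType).
Variables (H : normedModType R[i]) (ip : {dot H for Num.conj}).
Hypothesis hip : norm_induced_by ip.
Hypothesis hH : separable H.
Implicit Types f h : T -> H.

Definition weakly_measurable f :=
  forall u : H, measurable_complex (fun x => ip (f x) u).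

Lemma weakly_measurable_cst (u : H) : weakly_measurable (fun _ => u).
Proof. by move=> v; exact: measurable_complex_cst. Qed.

Lemma weakly_measurableD f h : weakly_measurable f -> weakly_measurable h ->
  weakly_measurable (fun x => f x + h x).
Proof.
by move=> mf mh u; under eq_fun do rewrite ip_addl; exact: measurable_complexD.
Qed.

Lemma weakly_measurableZ (k : T -> R[i]) f : measurable_complex k ->
  weakly_measurable f -> weakly_measurable (fun x => k x *: f x).
Proof.
by move=> mk mf u; under eq_fun do rewrite ip_scalel; exact: measurable_complexM.
Qed.

Lemma dense_sequence : exists e : nat -> H,
  forall u (r : R), 0 < r -> exists k, hnorm (u - e k) < r.
Proof.
have [D cD dD] := hH.
case/pfcard_geP: cD => [D0|[e]].
  have /dD/(_ openT)[u []] : [set: H] !=set0 by exists 0.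
  by rewrite D0.
exists e => u r r0.
have rC : 0 < r%:C%C by rewrite ltcR.
have /dD/(_ (ball_open _ _))[v [uv Dv]] : ball u r%:C%C !=set0.
  by exists u; exact: ballxx.
have /(_ v Dv)[k _ ekv] : set_surj setT D e by exact: surj.
exists k; rewrite ekv.
by move: uv; rewrite -ball_normE/= normHE ltcR.
Qed.

(** Along a dense sequence [e], the squared norm of [u] is the supremum of
    [2 Re <u, e k> - |e k|^2], because it exceeds the [k]-th term by
    [|u - e k|^2].  So weak measurability already controls norms. *)
Lemma measurable_sqr_hnorm f : weakly_measurable f ->
  measurable_fun setT (fun x => hnorm (f x) ^+ 2).
Proof.
move=> mf; have [e de] := dense_sequence.
pose F k x := (2 * rip ip (f x) (e k) - hnorm (e k) ^+ 2)%:E.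
have mF k : measurable_fun setT (F k).
  apply/measurable_EFinP; apply: measurable_funB => //.
  by apply: measurable_funM => //; have [] := mf (e k).
apply/measurable_EFinP; rewrite [X in measurable_fun _ X](_ : _ = fun x => esups (F ^~ x) 0).
  exact: measurable_fun_esups.
apply/funext => x /=; apply/eqP; rewrite eq_le; apply/andP; split.
  apply/lee_addgt0Pr => r r0.
  have [|k fe] := de (f x) (Num.sqrt r); first by rewrite sqrtr_gt0.
  have {fe} : hnorm (f x - e k) ^+ 2 < r.
    by rewrite -[ltRHS]sqr_sqrtr ?ltW// ltr_pXn2r// ?nnegrE ?hnorm_ge0 ?sqrtr_ge0.
  rewrite (sqr_hnormB hip) => fe.
  apply: (@le_trans _ _ (F k x + r%:E)%E); first by rewrite -EFinD lee_fin; lra.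
  by rewrite leeD2r//; apply: ereal_sup_ubound; exists k.
apply: ge_ereal_sup => _ [k _ <-]; rewrite lee_fin.
have := sqr_ge0 (hnorm (f x - e k)); rewrite (sqr_hnormB hip); lra.
Qed.

(** Polarization, from the measurability of squared norms. *)
Lemma measurable_ip f h : weakly_measurable f -> weakly_measurable h ->
  measurable_complex (fun x => ip (f x) (h x)).
Proof.
move=> mf mh.
have mrip k : weakly_measurable k -> measurable_fun setT (fun x => rip ip (f x) (k x)).
  move=> mk; rewrite [X in measurable_fun _ X](_ : _ = fun x =>
    2^-1 * (hnorm (f x + k x) ^+ 2 - hnorm (f x) ^+ 2 - hnorm (k x) ^+ 2)).
    apply: measurable_funM => //; do 2?apply: measurable_funB;
      by apply: measurable_sqr_hnorm => //; exact: weakly_measurableD.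
  by apply/funext => x; rewrite (sqr_hnormD hip); field.
split; first exact: mrip.
under eq_fun do rewrite Im_ip.
by apply: mrip; apply: weakly_measurableZ => //; exact: measurable_complex_cst.
Qed.

End WeakMeasurability.

(** * Completeness of L1 *)

Section L1.
Context (d : measure_display) (X : measurableType d) (R : realType).
Variable mu : {measure set X -> \bar R}.

Definition Rintegrable (f : X -> R) := mu.-integrable setT (EFin \o f).

Lemma Rintegrable_dominated (f g : X -> R) : measurable_fun setT f ->
  Rintegrable g -> (forall x, `|f x| <= g x) -> Rintegrable f.
Proof.
move=> mf ig fg; apply: le_integrable ig => //; first exact/measurable_EFinP.
move=> x _ /=; rewrite lee_fin; apply: le_trans (fg x) _; exact: ler_norm.
Qed.

Lemma measurable_Rintegrable (f : X -> R) : Rintegrable f -> measurable_fun setT f.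
Proof. by move/measurable_int/measurable_EFinP. Qed.

Lemma RintegrableD (f g : X -> R) : Rintegrable f -> Rintegrable g ->
  Rintegrable (fun x => f x + g x).
Proof. by move=> fi gi; have := integrableD measurableT fi gi; apply: eq_integrable. Qed.

Lemma RintegrableB (f g : X -> R) : Rintegrable f -> Rintegrable g ->
  Rintegrable (fun x => f x - g x).
Proof. by move=> fi gi; have := integrableB measurableT fi gi; apply: eq_integrable. Qed.

Lemma RintegrableZ (c : R) (f : X -> R) : Rintegrable f ->
  Rintegrable (fun x => c * f x).
Proof. by move=> fi; have := integrableZl measurableT c fi; apply: eq_integrable. Qed.

Lemma Rintegrable_norm (f : X -> R) : Rintegrable f -> Rintegrable (fun x => `|f x|).
Proof. exact: integrable_norm. Qed.

Lemma fin_integral (f : X -> R) : Rintegrable f ->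
  (\int[mu]_x (f x)%:E = (\int[mu]_x f x)%:E)%E.
Proof. by move=> fi; rewrite /Rintegral fineK// integrable_fin_num. Qed.

Lemma Rintegrable_ge0 (f : X -> R) : measurable_fun setT f -> (forall x, 0 <= f x) ->
  (\int[mu]_x (f x)%:E < +oo)%E -> Rintegrable f.
Proof.
move=> mf f0 fi; apply/integrableP; split; first exact/measurable_EFinP.
by under eq_integral do rewrite /= ger0_norm//.
Qed.

Definition ae_bounded (k : X -> R) := exists C, \forall x \ae mu, `|k x| <= C.

Lemma Rintegrable_bounded_mul (k f : X -> R) : measurable_fun setT k ->
  ae_bounded k -> Rintegrable f -> Rintegrable (fun x => k x * f x).
Proof.
move=> mk [C kC] fi; apply/integrableP; split.
  by apply/measurable_EFinP/measurable_funM => //; exact: measurable_Rintegrable.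
have Cf : Rintegrable (fun x => `|C| * `|f x|).
  by apply: RintegrableZ; exact: Rintegrable_norm.
have /integrableP[mCf] := Cf; apply: le_lt_trans.
apply: ae_ge0_le_integral => //=.
- apply/measurable_EFinP/measurableT_comp => //; apply: measurable_funM => //.
  exact: measurable_Rintegrable.
- by apply/measurable_EFinP/measurableT_comp => //; exact/measurable_EFinP.
- apply: filterS kC => x kx _; rewrite lee_fin normrM normrM normr_id normr_id.
  by rewrite ler_wpM2r// (le_trans kx)// ler_norm.
Qed.

(** Riesz-Fischer for sequences with geometrically small increments: the sum [S]
    of the increments is integrable, hence almost everywhere finite; it makes
    [u] converge almost everywhere, and [|u 0| + S] dominates [u].  The limit is
    defined as an upper limit, so that it is measurable on the whole space. *)
Lemma L1_complete (u : nat -> X -> R) (C : R) :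
  (forall n, Rintegrable (u n)) ->
  (forall n, \int[mu]_x `|u n.+1 x - u n x| <= C * 2^-1 ^+ n) ->
  exists2 f, Rintegrable f &
    (fun n => \int[mu]_x `|u n x - f x|) @ \oo --> (0 : R).
Proof.
move=> ui uC.
have mu_ n := measurable_Rintegrable (ui n).
pose D n x := `|u n.+1 x - u n x|%:E.
pose S x := (\sum_(0 <= n <oo) D n x)%E.
have mD n : measurable_fun setT (D n).
  by apply/measurable_EFinP/measurableT_comp => //; exact: measurable_funB.
have D0 n x : (0 <= D n x)%E by rewrite lee_fin.
have Di n : (\int[mu]_x D n x <= (C * 2^-1 ^+ n)%:E)%E.
  rewrite fin_integral ?lee_fin//.
  by apply: Rintegrable_norm; exact: RintegrableB.
have mS : measurable_fun setT S by exact: ge0_emeasurable_sum.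
have S0 x : (0 <= S x)%E by exact: nneseries_ge0.
have C0 : 0 <= C.
  have := uC 0; rewrite expr0 mulr1; apply: le_trans; exact: Rintegral_ge0.
have Si : mu.-integrable setT S.
  apply/integrableP; split => //; under eq_integral do rewrite gee0_abs//.
  rewrite integral_nneseries//.
  apply: (@le_lt_trans _ _ (\sum_(0 <= n <oo) (C * 2^-1 ^+ n)%:E)%E).
    by apply: lee_nneseries => [n _ _|n _]; [exact: integral_ge0|exact: Di].
  apply: (@le_lt_trans _ _ (C * 2)%:E); last exact: ltry.
  apply: lime_le.
    by apply: is_cvg_nneseries => n _ _; rewrite lee_fin mulr_ge0// exprn_ge0.
  apply: nearW => n; rewrite sumEFin lee_fin -mulr_sumr ler_wpM2l//.
  suff -> : \sum_(0 <= k < n) 2^-1 ^+ k = 2 - 2 * 2^-1 ^+ n :> R.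
    by rewrite gerBl mulr_ge0// exprn_ge0.
  elim: n => [|n ih]; first by rewrite big_nil expr0 mulr1 subrr.
  by rewrite big_nat_recr//= ih exprS; field.
pose g x := (`|u 0 x|%:E + S x)%E.
pose f x := fine (limn_esup (fun n => (u n x)%:E)).
have Sfin : \forall x \ae mu, S x \is a fin_num.
  by apply: filterS (integrable_ae measurableT Si) => x; apply.
have uf x : S x \is a fin_num -> (u n x)%:E @[n --> \oo] --> (f x)%:E.
  move=> Sx; have sumS n : \sum_(0 <= k < n) `|u k.+1 x - u k x| <= fine (S x).
    rewrite -lee_fin fineK// -sumEFin; apply: nneseries_lim_ge => k _ _; exact: D0.
  have /cvg_ex[l ul] : cvgn (fun n => u n x).
    rewrite [X in cvgn X](_ : _ = fun n => u 0 x + series (telescope (u ^~ x)) n).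
      apply: is_cvgD; first exact: is_cvg_cst.
      apply: normed_cvg; apply: nondecreasing_is_cvgn.
        by apply: nondecreasing_series => n _ _; exact: normr_ge0.
      by exists (fine (S x)) => _ [n _ <-]; exact: sumS.
    by apply/funext => n; rewrite -eq_sum_telescope.
  have uln : (u n x)%:E @[n --> \oo] --> l%:E by apply: cvg_EFin => //; exact: nearW.
  by rewrite /f (cvg_limn_einf_sup uln).2.
have ug x n : (`|(u n x)%:E| <= g x)%E.
  rewrite /g -[u n x](subrK (u 0 x)) [(_ - _ + _)%R]addrC.
  rewrite -(telescope_sumr (u ^~ x) (leq0n n)).
  apply: (@le_trans _ _ (`|u 0 x| + \sum_(0 <= k < n) `|u k.+1 x - u k x|)%:E).
    rewrite lee_fin (le_trans (ler_normD _ _))// lerD2l ler_norm_sum//.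
  rewrite EFinD leeD2l// -sumEFin; apply: nneseries_lim_ge => k _ _; exact: D0.
have gi : mu.-integrable setT g.
  apply: integrableD => //; exact: (Rintegrable_norm (ui 0)).
have mf : measurable_fun setT (EFin \o f).
  apply/measurable_EFinP; apply: measurableT_comp => //.
  by apply: measurable_fun_limn_esup => n; exact/measurable_EFinP.
have [fi fcvg _] := @dominated_convergence _ _ _ mu setT measurableT
  (fun n x => (u n x)%:E) (EFin \o f) g
  (fun n => (measurable_EFinP _ _).2 (mu_ n)) mf
  (filterS (fun x h _ => uf x h) Sfin) gi (aeW _ (fun x n _ => ug x n)).
exists f => //.
exact: fine_cvg fcvg.
Qed.
End L1.

(** * The space L2 of vector-valued functions *)

Section L2.
Context (d : measure_display) (X : measurableType d) (R : realType).
Variables (mu : {measure set X -> \bar R}).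
Variables (H : normedModType R[i]) (ip : {dot H for Num.conj}).
Hypothesis hip : norm_induced_by ip.
Hypothesis hH : separable H.
Implicit Types f h : X -> H.
Let vL2 := vector_L2 mu ip.

Lemma L2normE f : L2norm mu f = sqrte (\int[mu]_x (hnorm (f x) ^+ 2)%:E).
Proof.
rewrite /L2norm Lnorm.unlock poweR12_sqrt; last by apply: integral_ge0 => x _; exact: poweR_ge0.
congr sqrte; apply: eq_integral => x _ /=.
by rewrite ger0_norm ?hnorm_ge0// powR_mulrn ?hnorm_ge0.
Qed.

Lemma lt_L2norm f (e : R) : 0 < e ->
  (L2norm mu f < e%:E)%E = (\int[mu]_x (hnorm (f x) ^+ 2)%:E < (e ^+ 2)%:E)%E.
Proof.
move=> e0; have -> : e%:E = sqrte (e ^+ 2)%:E by rewrite /= sqrtr_sqr gtr0_norm.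
rewrite L2normE !ltNge lee_sqrt//.
by apply: integral_ge0 => x _; rewrite lee_fin sqr_ge0.
Qed.

Lemma vector_L2P f : vL2 f <->
  weakly_measurable ip f /\ Rintegrable mu (fun x => hnorm (f x) ^+ 2).
Proof.
split=> -[mf fi]; split => //.
  apply: Rintegrable_ge0 => [|x|]; [exact: measurable_sqr_hnorm|exact: sqr_ge0|].
  by move: fi; rewrite L2normE; case: (integral mu setT _) => //= r _; exact: ltry.
have fin : (\int[mu]_x (hnorm (f x) ^+ 2)%:E)%E \is a fin_num by exact: integrable_fin_num.
by move: fin; rewrite L2normE; case: (integral mu setT _) => //= r _; exact: ltry.
Qed.

Definition sqL2 f := \int[mu]_x hnorm (f x) ^+ 2.
Definition rdot f h := \int[mu]_x rip ip (f x) (h x).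

Lemma sqL2_ge0 f : 0 <= sqL2 f.
Proof. by apply: Rintegral_ge0 => x _; exact: sqr_ge0. Qed.

Lemma integral_sqr_hnorm f : vL2 f ->
  (\int[mu]_x (hnorm (f x) ^+ 2)%:E = (sqL2 f)%:E)%E.
Proof. by move=> /vector_L2P[_ fi]; exact: fin_integral. Qed.

Lemma vL2_lt_L2norm f (e : R) : vL2 f -> 0 < e -> (L2norm mu f < e%:E)%E = (sqL2 f < e ^+ 2).
Proof. by move=> fL e0; rewrite lt_L2norm// integral_sqr_hnorm// lte_fin. Qed.

Lemma vector_L2_dominated f (g : X -> R) : weakly_measurable ip f -> Rintegrable mu g ->
  (forall x, hnorm (f x) ^+ 2 <= g x) -> vL2 f.
Proof.
move=> mf gi fg; apply/vector_L2P; split => //.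
apply: Rintegrable_dominated gi _ => [|x]; first exact: measurable_sqr_hnorm.
by rewrite ger0_norm ?sqr_ge0.
Qed.

Lemma vector_L2_0 : vL2 (fun _ => 0).
Proof.
apply: (@vector_L2_dominated _ (fun => 0)); first exact: weakly_measurable_cst.
  exact: integrable0.
by move=> x; rewrite hnorm0 expr0n.
Qed.

Lemma sqr_hnorm_subadd (u v : H) :
  hnorm (u + v) ^+ 2 <= 2 * hnorm u ^+ 2 + 2 * hnorm v ^+ 2.
Proof.
have := sqr_ge0 (hnorm (u - v)); rewrite (sqr_hnormB hip) (sqr_hnormD hip); lra.
Qed.

Lemma vector_L2D f h : vL2 f -> vL2 h -> vL2 (fun x => f x + h x).
Proof.
move=> /vector_L2P[mf fi] /vector_L2P[mh hi].
apply: (@vector_L2_dominated _ (fun x => 2 * hnorm (f x) ^+ 2 + 2 * hnorm (h x) ^+ 2)).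
- exact: weakly_measurableD.
- by apply: RintegrableD; exact: RintegrableZ.
- by move=> x; exact: sqr_hnorm_subadd.
Qed.

Definition ae_bounded_complex (k : X -> R[i]) := exists C, \forall x \ae mu, normc (k x) <= C.

Lemma vector_L2_mul (k : X -> R[i]) f : measurable_complex k ->
  ae_bounded_complex k -> vL2 f -> vL2 (fun x => k x *: f x).
Proof.
move=> mk [C kC] /vector_L2P[mf fi]; apply/vector_L2P; split.
  exact: weakly_measurableZ.
under eq_fun do rewrite hnormZ exprMn.
apply: Rintegrable_bounded_mul fi; first exact: measurable_sqr_normc.
exists (C ^+ 2); apply: filterS kC => x kx.
by rewrite ger0_norm ?sqr_ge0// ler_pXn2r// nnegrE ?normc_ge0// (le_trans (normc_ge0 (k x))).
Qed.

Lemma vector_L2Z (c : R[i]) f : vL2 f -> vL2 (fun x => c *: f x).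
Proof.
move=> fL; apply: (@vector_L2_mul (fun => c)) => //.
by exists (normc c); exact: nearW.
Qed.

Lemma vector_L2B f h : vL2 f -> vL2 h -> vL2 (fun x => f x - h x).
Proof.
move=> fL hL; under eq_fun do rewrite -scaleN1r.
by apply: vector_L2D => //; exact: vector_L2Z.
Qed.

Lemma vector_L2_sum n (F : 'I_n -> X -> H) :
  (forall i, vL2 (F i)) -> vL2 (fun x => \sum_i F i x).
Proof.
elim: n F => [F _|n ih F FL].
  by under eq_fun do rewrite big_ord0; exact: vector_L2_0.
under eq_fun do rewrite big_ord_recr/=.
by apply: vector_L2D => //; apply: ih.
Qed.

(** The free parameter [t] trades one factor against the other: with [t = 2^n]
    it makes an increment of squared size [4^-n] contribute only [2^-n]. *)
Lemma ler_normc_ip (t : R) (u v : H) : 0 < t ->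
  normc (ip u v) <= t * hnorm u ^+ 2 + t^-1 * hnorm v ^+ 2.
Proof.
move=> t0; apply: (le_trans (cauchy_schwarz hip u v)).
have := sqr_ge0 (t * hnorm u - hnorm v).
have : 0 <= (t * hnorm u) ^+ 2 + hnorm v ^+ 2 by rewrite addr_ge0 ?sqr_ge0.
rewrite sqrrB => h1 h2.
have {h1 h2} : t * (hnorm u * hnorm v) <= t * (t * hnorm u ^+ 2 + t^-1 * hnorm v ^+ 2).
  by rewrite [leRHS]mulrDr [t * (t^-1 * _)]mulVKf ?gt_eqF//; lra.
by rewrite ler_pM2l.
Qed.

Lemma integrable_ip f h : vL2 f -> vL2 h ->
  Rintegrable mu (fun x => Re (ip (f x) (h x))) /\
  Rintegrable mu (fun x => Im (ip (f x) (h x))).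
Proof.
move=> /vector_L2P[mf fi] /vector_L2P[mh hi].
have [mR mI] := measurable_ip hip hH mf mh.
have gi : Rintegrable mu (fun x => 1 * hnorm (f x) ^+ 2 + 1^-1 * hnorm (h x) ^+ 2).
  by apply: RintegrableD; exact: RintegrableZ.
by split; apply: (Rintegrable_dominated _ gi) => // x;
  apply: le_trans (ler_normc_ip _ _ _) => //; [exact: ler_Re_normc|exact: ler_Im_normc].
Qed.

Lemma integrable_rip f h : vL2 f -> vL2 h -> Rintegrable mu (fun x => rip ip (f x) (h x)).
Proof. by move=> fL hL; have [] := integrable_ip fL hL. Qed.

Lemma rdotBl f1 f2 h : vL2 f1 -> vL2 f2 -> vL2 h ->
  rdot (fun x => f1 x - f2 x) h = rdot f1 h - rdot f2 h.
Proof.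
move=> f1L f2L hL; rewrite /rdot; under eq_Rintegral do rewrite rip_subl.
by apply: RintegralB => //; exact: integrable_rip.
Qed.

Lemma rdotC f h : rdot f h = rdot h f.
Proof. by apply: eq_Rintegral => x _; rewrite ripC. Qed.

Lemma rdotBr f1 f2 h : vL2 f1 -> vL2 f2 -> vL2 h ->
  rdot h (fun x => f1 x - f2 x) = rdot h f1 - rdot h f2.
Proof. by move=> f1L f2L hL; rewrite rdotC rdotBl// rdotC [rdot f2 h]rdotC. Qed.

Lemma rdot_sqL2 f : rdot f f = sqL2 f.
Proof. by apply: eq_Rintegral => x _; rewrite /rip ip_hnorm. Qed.

Lemma rdot_sum n (F : 'I_n -> X -> H) h : (forall i, vL2 (F i)) -> vL2 h ->
  rdot h (fun x => \sum_i F i x) = \sum_i rdot h (F i).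
Proof.
move=> FL hL; elim: n F FL => [F _|n ih F FL].
  rewrite big_ord0 /rdot; under eq_Rintegral do rewrite big_ord0 /rip linear0r/=.
  by rewrite Rintegral_cst// mul0r.
rewrite big_ord_recr/= -ih// /rdot.
under eq_Rintegral do rewrite big_ord_recr/= /rip ip_addr addCE/=.
apply: RintegralD => //; apply: integrable_rip => //; exact: vector_L2_sum.
Qed.

Lemma sqL2B f h (t : R) : vL2 f -> vL2 h ->
  sqL2 (fun x => f x - t%:C%C *: h x) = sqL2 f - 2 * t * rdot f h + t ^+ 2 * sqL2 h.
Proof.
move=> fL hL; have [[mf fi] [mh hi]] := ((vector_L2P f).1 fL, (vector_L2P h).1 hL).
rewrite /sqL2 /rdot; have fhi := integrable_rip fL hL.
under eq_Rintegral => x _.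
  rewrite (sqr_hnormB hip) hnormZ exprMn normc2E /rip ip_scaler conjCE mulCE/=.
  rewrite oppr0 mul0r subr0 expr0n addr0 mulrA.
  over.
rewrite /= RintegralD//; [|by apply: RintegrableB => //; exact: RintegrableZ|exact: RintegrableZ].
rewrite RintegralB//; last exact: RintegrableZ.
by rewrite !RintegralZl.
Qed.

Lemma sqL2B1 f h : vL2 f -> vL2 h ->
  sqL2 (fun x => f x - h x) = sqL2 f - 2 * rdot f h + sqL2 h.
Proof.
move=> fL hL; have := sqL2B 1 fL hL; rewrite mulr1 expr1n mul1r => <-.
by congr Rintegral; apply/funext => x; rewrite scale1r.
Qed.

End L2.

(** * Spans, bounded test functions and minimizing residuals *)

Section Span.
Variables (K : pzRingType) (V : lmodType K).
Implicit Types (A : set V) (u v : V).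

Lemma mem_span A v : A v -> span A v.
Proof. by move=> Av; exists 1%N, (fun => 1), (fun => v); rewrite big_ord1 scale1r. Qed.

Lemma span0 A : span A 0.
Proof. by exists 0%N, (fun => 0), (fun => 0); rewrite big_ord0; split => // -[]. Qed.

Lemma spanD A u v : span A u -> span A v -> span A (u + v).
Proof.
move=> [n [c [a [Aa ->]]]] [m [e [b [Ab ->]]]].
exists (n + m)%N.
exists (fun i => match fintype.split i with inl j => c j | inr j => e j end).
exists (fun i => match fintype.split i with inl j => a j | inr j => b j end).
split=> [i|]; first by case: (fintype.split i).
rewrite big_split_ord/=; congr (_ + _); apply: eq_bigr => i _.
  by rewrite -[lshift _ _]/(unsplit (inl i)) unsplitK.
by rewrite -[rshift _ _]/(unsplit (inr i)) unsplitK.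
Qed.

Lemma spanZ A c u : span A u -> span A (c *: u).
Proof.
move=> [n [e [a [Aa ->]]]]; exists n, (fun i => c * e i), a; split => //.
by rewrite scaler_sumr; apply: eq_bigr => i _; rewrite scalerA.
Qed.
End Span.

Section EssentiallyBounded.
Context (d : measure_display) (X : measurableType d) (R : realType).
Variables (mu : {measure set X -> \bar R}).

Lemma Linfty_bounded (k : X -> R[i]) : complex_Lp mu +oo%E k ->
  measurable_complex k /\ ae_bounded_complex mu k.
Proof.
move=> [mk]; rewrite Lnorm.unlock; case: ifPn => [mu0|mu0 _]; last first.
  split=> //; exists 0; exists setT; split => //.
  by apply/eqP; rewrite -measure_le0 leNgt.
set e := ess_sup _ _ => e_lty; split=> //.
have := ess_sup_ge mu (abse \o (fun x => (normc (k x))%:E)); rewrite -/e.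
move: e e_lty => [r _|//|_] h.
  by exists r; apply: filterS h => x /=; rewrite lee_fin ger0_norm ?normc_ge0.
by exists 0; apply: filterS h => x /=.
Qed.

Lemma L1_tested (k u f : X -> R) (C : R) : 0 <= C -> measurable_fun setT k ->
  (\forall x \ae mu, `|k x| <= C) -> Rintegrable mu u -> Rintegrable mu f ->
  `|\int[mu]_x (k x * u x) - \int[mu]_x (k x * f x)| <= C * \int[mu]_x `|u x - f x|.
Proof.
move=> C0 mk kC ui fi.
have bk : ae_bounded mu k by exists C.
have ufi : Rintegrable mu (fun x => u x - f x) by exact: RintegrableB.
have nufi : Rintegrable mu (fun x => `|u x - f x|) by exact: Rintegrable_norm.
have kufi : Rintegrable mu (fun x => k x * (u x - f x)) by exact: Rintegrable_bounded_mul.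
rewrite -RintegralB//; [|exact: Rintegrable_bounded_mul..].
under eq_Rintegral do rewrite -mulrBr.
apply: (le_trans (le_normr_Rintegral _ _)) => //.
rewrite -RintegralZl//.
rewrite /Rintegral fine_le//.
- by apply: integrable_fin_num => //; exact: Rintegrable_norm.
- by apply: integrable_fin_num => //; exact: RintegrableZ.
apply: ae_ge0_le_integral => //.
- exact: (measurable_int _ (Rintegrable_norm kufi)).
- by move=> x _; rewrite lee_fin mulr_ge0.
- exact: (measurable_int _ (RintegrableZ C nufi)).
- by apply: filterS kC => x kx _; rewrite lee_fin normrM ler_wpM2r.
Qed.

Lemma cvg_tested (k f : X -> R) (u : nat -> X -> R) : measurable_fun setT k ->
  ae_bounded mu k -> (forall n, Rintegrable mu (u n)) -> Rintegrable mu f ->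
  (fun n => \int[mu]_x `|u n x - f x|) @ \oo --> (0 : R) ->
  (fun n => \int[mu]_x (k x * u n x)) @ \oo --> \int[mu]_x (k x * f x).
Proof.
move=> mk [C kC] ui fi uf; apply/cvgrPdist_le => e e0.
have kC' : \forall x \ae mu, `|k x| <= `|C|.
  by apply: filterS kC => x kx; exact: le_trans (ler_norm _).
have : (fun n => `|C| * \int[mu]_x `|u n x - f x|) @ \oo --> (0 : R).
  by rewrite -[X in _ --> X](mulr0 `|C|); apply: cvgM uf; exact: cvg_cst.
move/cvgrPdist_le => /(_ e e0); apply: filterS => n.
rewrite sub0r normrN ger0_norm; last first.
  by rewrite mulr_ge0//; apply: Rintegral_ge0.
by apply: le_trans; rewrite distrC; exact: L1_tested.
Qed.
End EssentiallyBounded.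

Section Residuals.
Context (d : measure_display) (X : measurableType d) (R : realType).
Variables (mu : {measure set X -> \bar R}).
Variables (H : normedModType R[i]) (ip : {dot H for Num.conj}).
Hypothesis hip : norm_induced_by ip.
Hypothesis hH : separable H.
Let vL2 := vector_L2 mu ip.
Variables (V : set (X -> H)) (T : X -> H).
Hypothesis VL2 : V `<=` vL2.
Hypothesis V0 : V (fun=> 0).
Hypothesis VD : forall p q (c : R[i]), V p -> V q -> V (fun x => p x + c *: q x).
Hypothesis TL2 : vL2 T.

Let r n : R := 4^-1 ^+ n.

Lemma minimizing_sequence : exists p : nat -> X -> H, (forall n, V (p n)) /\
  forall n q, V q ->
    sqL2 mu (fun x => T x - p n x) < sqL2 mu (fun x => T x - q x) + r n.
Proof.
pose S := [set sqL2 mu (fun x => T x - q x) | q in V].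
have infS : has_inf S.
  split; first by exists (sqL2 mu (fun x => T x - 0)); exists (fun=> 0).
  by exists 0 => _ [q _ <-]; exact: sqL2_ge0.
have /choice[p hp] n : exists p, V p /\ sqL2 mu (fun x => T x - p x) < inf S + r n.
  have r0 : 0 < r n by rewrite exprn_gt0.
  by have [_ [p Vp <-] lt_p] := inf_adherent r0 infS; exists p.
exists p; split=> [n|n q Vq]; first by case: (hp n).
have [_ /lt_le_trans] := hp n; apply; rewrite lerD2r.
by apply: ge_inf; [exact: infS.2|exists q].
Qed.

Variable p : nat -> X -> H.
Hypothesis Vp : forall n, V (p n).
Hypothesis p_min : forall n q, V q ->
    sqL2 mu (fun x => T x - p n x) < sqL2 mu (fun x => T x - q x) + r n.

Let rho n x := T x - p n x.

Let rhoL n : vL2 (rho n).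
Proof. by apply: vector_L2B => //; exact: VL2. Qed.

Let VB q1 q2 : V q1 -> V q2 -> V (fun x => q1 x - q2 x).
Proof.
by move=> V1 V2; under eq_fun do rewrite -scaleN1r; exact: VD.
Qed.

Let shift n (h : X -> H) (t : R) : V h ->
  sqL2 mu (rho n) < sqL2 mu (fun x => rho n x - t%:C%C *: h x) + r n.
Proof.
move=> Vh; have := p_min n (VD t%:C%C (Vp n) Vh).
by congr (_ < sqL2 _ _ + _); apply/funext => x; rewrite opprD addrA.
Qed.

(** Compare [p n] with the competitor [p n + t h]. *)
Lemma residual_almost_orthogonal n h t : V h ->
  2 * t * rdot mu ip (rho n) h < r n + t ^+ 2 * sqL2 mu h.
Proof.
move=> Vh; have := shift n t Vh; rewrite (sqL2B hip hH _ (rhoL n) (VL2 Vh)); lra.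
Qed.

(** The parallelogram law, with the midpoint of [p m] and [p n] as competitor. *)
Lemma residual_cauchy m n :
  sqL2 mu (fun x => p m x - p n x) < 2 * (r m + r n).
Proof.
set h := (fun x => _).
have Vh : V h by exact: VB.
have := shift n 2^-1 Vh.
have := p_min m (VD (2^-1)%:C%C (Vp n) Vh).
have -> : (fun x => T x - p m x) = (fun x => rho n x - h x).
  by apply/funext => x; rewrite /rho /h opprB addrA subrK.
have -> : (fun x => T x - (p n x + (2^-1)%:C%C *: h x)) =
  (fun x => rho n x - (2^-1)%:C%C *: h x).
  by apply/funext => x; rewrite /rho opprD addrA.
rewrite (sqL2B1 hip hH (rhoL n) (VL2 Vh)) (sqL2B hip hH _ (rhoL n) (VL2 Vh)); lra.
Qed.

(** The scalar functions [<rho n, phi>] form a Cauchy sequence in L1, so that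
    their limit can be tested against every bounded function at once.  This
    replaces a limit of [rho n] itself in L2. *)
Lemma residual_weak_limit phi : vL2 phi -> exists2 f : X -> R[i],
  Rintegrable mu (fun x => Re (f x)) /\ Rintegrable mu (fun x => Im (f x)) &
  forall k, measurable_complex k -> ae_bounded_complex mu k ->
    (fun n => rdot mu ip (rho n) (fun x => k x *: phi x)) @ \oo -->
    \int[mu]_x Re (f x * Num.conj (k x)).
Proof.
move=> phiL.
(* An increment has squared L2 size below 2 (4^-n + 4^-(n+1)), that is
   (5 / 2) 4^-n, and 5 / 2 <= 3. *)
pose C : R := 3 + sqL2 mu phi.
have step n (P : R[i] -> R) : (forall z w, P (z - w) = P z - P w) ->
    (forall z, `|P z| <= normc z) ->
    (forall h, vL2 h -> Rintegrable mu (fun x => P (ip (h x) (phi x)))) ->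
    \int[mu]_x `|P (ip (rho n.+1 x) (phi x)) - P (ip (rho n x) (phi x))| <= C * 2^-1 ^+ n.
  move=> PB Pn Pi; pose h x := p n x - p n.+1 x.
  have hL : vL2 h by apply: VL2; exact: VB.
  have /vector_L2P[//|//|_ hi] := hL; have /vector_L2P[//|//|_ phii] := phiL.
  under eq_Rintegral => x _.
    rewrite -PB -ip_subl (_ : _ - _ = h x); last first.
      by rewrite /rho /h opprB addrC addrA subrK.
    over.
  apply: (@le_trans _ _ (\int[mu]_x (2 ^+ n * hnorm (h x) ^+ 2 +
                                     (2 ^+ n)^-1 * hnorm (phi x) ^+ 2))).
    apply: le_Rintegral => //.
    - exact/Rintegrable_norm/Pi.
    - by apply: RintegrableD; exact: RintegrableZ.
    - by move=> x _; apply: le_trans (Pn _) _; apply: ler_normc_ip => //; rewrite exprn_gt0.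
  rewrite RintegralD//; [|exact: RintegrableZ..].
  rewrite !RintegralZl// -/(sqL2 mu h) -/(sqL2 mu phi).
  have := ltW (residual_cauchy n n.+1); rewrite -/h => hn.
  have rn : 2 ^+ n * r n = 2^-1 ^+ n by rewrite /r -exprMn; congr (_ ^+ _); field.
  have -> : (2 ^+ n)^-1 = 2^-1 ^+ n :> R by rewrite exprVn.
  have : 2 ^+ n * sqL2 mu h <= 2 ^+ n * (2 * (r n + r n.+1)) by rewrite ler_wpM2l// exprn_ge0.
  have -> : 2 ^+ n * (2 * (r n + r n.+1)) = (5 / 2) * (2 ^+ n * r n) by rewrite /r exprS; field.
  have : 0 <= 2^-1 ^+ n :> R by rewrite exprn_ge0.
  rewrite rn /C; lra.
have iRI n := integrable_ip hip hH (rhoL n) phiL.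
have [|n|fR fRi uR] := @L1_complete _ _ _ mu (fun n x => Re (ip (rho n x) (phi x))) C.
- by move=> n; case: (iRI n).
- apply: (step n (@complex.Re R)) => [z w|z|h hL]; [by rewrite addCE oppCE|exact: ler_Re_normc|].
  by case: (integrable_ip hip hH hL phiL).
have [|n|fI fIi uI] := @L1_complete _ _ _ mu (fun n x => Im (ip (rho n x) (phi x))) C.
- by move=> n; case: (iRI n).
- apply: (step n (@complex.Im R)) => [z w|z|h hL]; [by rewrite addCE oppCE|exact: ler_Im_normc|].
  by case: (integrable_ip hip hH hL phiL).
exists (fun x => Complex (fR x) (fI x)) => // k [mkR mkI] [D kD].
have bR : ae_bounded mu (fun x => Re (k x)).
  by exists D; apply: filterS kD => x; apply: le_trans; exact: ler_Re_normc.
have bI : ae_bounded mu (fun x => Im (k x)).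
  by exists D; apply: filterS kD => x; apply: le_trans; exact: ler_Im_normc.
have expand (z : X -> R[i]) : Rintegrable mu (fun x => Re (z x)) ->
    Rintegrable mu (fun x => Im (z x)) ->
    \int[mu]_x Re (z x * Num.conj (k x)) =
    \int[mu]_x (Re (k x) * Re (z x)) + \int[mu]_x (Im (k x) * Im (z x)).
  move=> zR zI; rewrite -RintegralD//; [|exact: Rintegrable_bounded_mul..].
  by apply: eq_Rintegral => x _; rewrite conjCE mulCE/=; ring.
rewrite expand//.
rewrite [X in X @ _ --> _](_ : _ = fun n =>
  \int[mu]_x (Re (k x) * Re (ip (rho n x) (phi x))) +
  \int[mu]_x (Im (k x) * Im (ip (rho n x) (phi x)))).
  by apply: cvgD; apply: cvg_tested => // n; case: (iRI n).
apply/funext => n; have [iR iI] := iRI n.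
by rewrite -expand//; apply: eq_Rintegral => x _; rewrite /rip ip_scaler mulrC.
Qed.

(** Almost orthogonality with [t = 2^-n] and [t = - 2^-n] bounds the inner
    product by [(1 + |h|^2) 2^-n]. *)
Lemma residual_orthogonal h : V h -> (fun n => rdot mu ip (rho n) h) @ \oo --> (0 : R).
Proof.
move=> Vh; apply/cvgr0Pnorm_le => e e0.
pose C := 1 + sqL2 mu h.
have C0 : 0 < C by rewrite ltr_pwDl// sqL2_ge0.
have : (fun n => C * 2^-1 ^+ n) @ \oo --> (0 : R).
  rewrite -[X in _ --> X](mulr0 C); apply: cvgM; first exact: cvg_cst.
  by apply: cvg_expr; rewrite ger0_norm// invf_lt1 ?ltr1n.
move/cvgr0Pnorm_le => /(_ e e0); apply: filterS => n.
apply: le_trans; rewrite [leRHS]ger0_norm; last by rewrite mulr_ge0 ?ltW// exprn_gt0.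
pose s : R := 2^-1 ^+ n.
have s0 : 0 < s by rewrite exprn_gt0.
have rs : r n = s ^+ 2 by rewrite /r /s -exprM mulnC exprM; congr (_ ^+ _); field.
have key t : t = s \/ t = - s -> 2 * t * rdot mu ip (rho n) h < s * (s * C).
  move=> ts; have := residual_almost_orthogonal n t Vh.
  by have -> : t ^+ 2 = s ^+ 2 by [case: ts => ->; rewrite ?sqrrN]; rewrite rs /C; lra.
have := key _ (or_introl erefl); have := key _ (or_intror erefl) => k1 k2.
have k3 : 0 <= s * C by rewrite mulr_ge0 ?ltW.
rewrite ler_norml; apply/andP; split.
  suff : s * - (C * s) <= s * rdot mu ip (rho n) h by rewrite ler_pM2l.
  have : 0 <= s * (s * C) by rewrite mulr_ge0// ltW.
  lra.
suff : s * rdot mu ip (rho n) h <= s * (C * s) by rewrite ler_pM2l.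
have : 0 <= s * (s * C) by rewrite mulr_ge0// ltW.
lra.
Qed.

End Residuals.

Lemma cvg_sum0 (R : realType) n (u : 'I_n -> nat -> R) :
  (forall i, u i @ \oo --> (0 : R)) -> (fun m => \sum_i u i m) @ \oo --> (0 : R).
Proof.
elim: n u => [u _|n ih u u0].
  by under eq_fun do rewrite big_ord0; exact: cvg_cst.
under eq_fun do rewrite big_ord_recr/=.
have := cvgD (ih (fun i => u (widen_ord (leqnSn n) i)) (fun i => u0 _)) (u0 ord_max).
rewrite addr0; exact.
Qed.

Lemma complex_L1 (d : measure_display) (X : measurableType d) (R : realType)
    (muX : {measure set X -> \bar R}) (f : X -> R[i]) :
  Rintegrable muX (fun x => Re (f x)) -> Rintegrable muX (fun x => Im (f x)) ->
  complex_Lp muX 1%E f.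
Proof.
move=> fR fI.
have mf : measurable_complex f.
  by split; [exact: (measurable_Rintegrable fR)|exact: (measurable_Rintegrable fI)].
split=> //; rewrite Lnorm1.
have nfi : Rintegrable muX (fun x => normc (f x)).
  apply: (Rintegrable_dominated _ (RintegrableD (Rintegrable_norm fR) (Rintegrable_norm fI))).
    rewrite [X in measurable_fun _ X](_ : _ = fun x => Num.sqrt (normc (f x) ^+ 2)).
      apply: (measurableT_comp (continuous_measurable_fun (@sqrt_continuous R))).
      exact: measurable_sqr_normc.
    by apply/funext => x; rewrite sqrtr_sqr ger0_norm ?normc_ge0.
  move=> x; rewrite ger0_norm ?normc_ge0//.
  rewrite -(@ler_pXn2r _ 2)// ?nnegrE ?normc_ge0 ?addr_ge0//.
  rewrite normc2E sqrrD -!(real_normK (num_real (Re _))) -!(real_normK (num_real (Im _))).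
  by rewrite lerD2r lerDl mulrn_wge0// mulr_ge0.
by have /integrableP[] := nfi.
Qed.

(** * Bounded combinations lie in the space spanned by the modulations *)

Section ParsevalDensity.
Context (dX dM : measure_display) (X : measurableType dX) (M : measurableType dM).
Context (R : realType).
Variables (muX : {measure set X -> \bar R}) (muM : {measure set M -> \bar R}).
Variable g : M -> X -> R[i].
Hypothesis hg : parseval_determining muX muM g.

(** The Parseval identity makes the coefficients determine a function of L1. *)
Lemma determining_eq0 (f : X -> R[i]) :
  Rintegrable muX (fun x => Re (f x)) -> Rintegrable muX (fun x => Im (f x)) ->
  (forall s, cintegral muX (fun x => f x * Num.conj (g s x)) = 0) ->
  \forall x \ae muX, f x = 0.
Proof.
move=> fR fI coef0; have [_ parseval] := hg.
have [mf _] := complex_L1 fR fI.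
have fL1 := complex_L1 fR fI.
have [_] := parseval f fL1.
under eq_integral do rewrite coef0 ComplexField.Normc.normc0 expr0n/=.
rewrite integral0 => /esym f0.
have msq : measurable_fun setT (fun x => (normc (f x) ^+ 2)%:E).
  by apply/measurable_EFinP; exact: measurable_sqr_normc.
have : (\int[muX]_x `|(normc (f x) ^+ 2)%:E| = 0)%E.
  by rewrite -[RHS]f0; apply: eq_integral => x _; rewrite gee0_abs// lee_fin sqr_ge0.
move/(ae_eq_integral_abs muX measurableT msq); apply: filterS => x /= /(_ I)[].
by move/eqP; rewrite sqrf_eq0 => /eqP/ComplexField.Normc.eq0_normc.
Qed.

Variables (H : normedModType R[i]) (ip : {dot H for Num.conj}).
Hypothesis hip : norm_induced_by ip.
Hypothesis hH : separable H.
Let vL2 := vector_L2 muX ip.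
Variable F : set (X -> H).
Hypothesis FL2 : F `<=` vL2.
Let V := span (modulations (range g) F).

Lemma modulation_L2 s f : vL2 f -> vL2 (fun x => g s x *: f x).
Proof. by move=> fL; have [mg bg] := Linfty_bounded (hg.1 s); exact: vector_L2_mul. Qed.

Lemma span_modulations_L2 : V `<=` vL2.
Proof.
move=> v [n [c [a [Va ->]]]].
rewrite [X in vL2 X](_ : _ = fun x => \sum_i c i *: a i x); last first.
  by apply/funext => x; rewrite fct_sumE; apply: eq_bigr.
apply: vector_L2_sum => // i; apply: vector_L2Z => //.
by have [_ [s _ <-] [f Ff ->]] := Va i; apply: modulation_L2; exact: FL2.
Qed.

Lemma span_modulationsD p q (c : R[i]) : V p -> V q -> V (fun x => p x + c *: q x).
Proof.
move=> Vp Vq; rewrite [X in V X](_ : _ = p + c *: q)//.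
by apply: spanD => //; exact: spanZ.
Qed.

(** Let [rho n] be the residuals of a minimizing sequence [p n] for the
    combination [T].  For each [phi] in [F], the L1 limit of [<rho n, phi>] has
    vanishing coefficients, as [rho n] becomes orthogonal to [g s *: phi] and to
    ['i *: g s *: phi]; hence it is zero.  So [rho n] becomes orthogonal to [T].
    It is also asymptotically orthogonal to [p n], and [|rho n|^2] is the
    difference of the two inner products. *)
Lemma bounded_combination_S n (k : 'I_n -> X -> R[i]) (phi : 'I_n -> X -> H) :
  (forall i, measurable_complex (k i)) -> (forall i, ae_bounded_complex muX (k i)) ->
  (forall i, F (phi i)) ->
  S_ muX ip (range g) F (fun x => \sum_i k i x *: phi i x).
Proof.
move=> mk bk Fphi; pose T x := \sum_i k i x *: phi i x.
rewrite -[X in S_ _ _ _ _ X]/T.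
have kphiL i : vL2 (fun x => k i x *: phi i x) by apply: vector_L2_mul => //; exact: FL2.
have TL : vL2 T by exact: vector_L2_sum.
split=> // e e0.
have V0 : V (fun=> 0) by exact: span0.
have [p [Vp p_min]] := minimizing_sequence muX T V0.
pose rho m x := T x - p m x.
have pL m := span_modulations_L2 (Vp m).
have rhoL m : vL2 (rho m) by exact: vector_L2B (pL m).
have orth h : V h -> (fun n => rdot muX ip (rho n) h) @ \oo --> (0 : R).
  exact: (residual_orthogonal hip hH span_modulations_L2 span_modulationsD TL Vp p_min).
have weak0 i : (fun n => rdot muX ip (rho n) (fun x => k i x *: phi i x)) @ \oo --> (0 : R).
  have [f [fR fI] fk] := residual_weak_limit hip hH span_modulations_L2
    span_modulationsD TL Vp p_min (FL2 (Fphi i)).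
  have f0 : \forall x \ae muX, f x = 0.
    apply: determining_eq0 => // s.
    have Vg : V (fun x => g s x *: phi i x).
      by apply: mem_span; exists (g s); [exists s|exists (phi i)].
    have [mg [C gC]] := Linfty_bounded (hg.1 s).
    rewrite /cintegral; congr Complex.
      have := fk (g s) mg (ex_intro _ C gC) => /cvg_unique; apply=> //.
      exact: orth.
    have mig : measurable_complex (fun x => Complex 0 1 * g s x).
      by apply: measurable_complexM => //; exact: measurable_complex_cst.
    have big : ae_bounded_complex muX (fun x => Complex 0 1 * g s x).
      exists C; apply: filterS gC => x.
      by rewrite ComplexField.Normc.normcM/= expr0n expr1n add0r sqrtr1 mul1r.
    transitivity (\int[muX]_x Re (f x * Num.conj (Complex 0 1 * g s x))).
      by apply: eq_Rintegral => x _; rewrite !conjCE !mulCE/=; ring.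
    have := fk _ mig big => /cvg_unique; apply=> //.
    rewrite (_ : (fun x => (Complex 0 1 * g s x) *: phi i x) =
        (fun x => Complex 0 1 *: (g s x *: phi i x))); last first.
      by apply/funext => x; rewrite scalerA.
    apply: orth; exact: (spanZ (Complex 0 1) Vg).
  rewrite -(_ : \int[muX]_x Re (f x * Num.conj (k i x)) = 0); first exact: fk.
  rewrite /Rintegral (@ae_eq_integralT _ _ _ muX _ (fun=> 0%E)) ?integral0//.
  by apply: filterS f0 => x ->; rewrite mul0r.
have rhoT : (fun n => rdot muX ip (rho n) T) @ \oo --> (0 : R).
  have rT m : rdot muX ip (rho m) T =
      \sum_i rdot muX ip (rho m) (fun x => k i x *: phi i x).
    by apply: rdot_sum => //; exact: rhoL.
  under eq_fun do rewrite rT.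
  exact: cvg_sum0.
(* K bounds 1 + |p m|^2, as |p m|^2 <= 2 |T|^2 + 2 |rho m|^2 and
   |rho m|^2 <= |T|^2 + 1. *)
pose K := 1 + 4 * sqL2 muX T + 2.
have K0 : 0 < K by rewrite /K; have := sqL2_ge0 muX T; lra.
have bound m : sqL2 muX (rho m) <= rdot muX ip (rho m) T + K * 2^-1 ^+ m.
  pose s : R := 2^-1 ^+ m.
  have s0 : 0 < s by rewrite exprn_gt0.
  have s1 : s <= 1 by rewrite exprn_ile1// ?invr_ge0// invf_le1// ler1n.
  have rs : 4^-1 ^+ m = s ^+ 2 by rewrite /s -exprM mulnC exprM; congr (_ ^+ _); field.
  have ss : s ^+ 2 <= 1 by rewrite exprn_ile1// ltW.
  have rhoK : sqL2 muX (rho m) <= sqL2 muX T + 1.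
    have := p_min m _ V0; rewrite rs (_ : (fun x => T x - 0) = T); last first.
      by apply/funext => x; rewrite subr0.
    move=> h; rewrite (le_trans (ltW h))// lerD2l//.
  have pK : sqL2 muX (p m) <= K - 1.
    have -> : p m = (fun x => T x - rho m x) by apply/funext => x; rewrite opprB addrC subrK.
    rewrite (sqL2B1 hip hH TL (rhoL m)).
    have := sqL2_ge0 muX (fun x => T x - (-1)%:C%C *: rho m x).
    by rewrite (sqL2B hip hH _ TL (rhoL m)) /K; lra.
  have almost := residual_almost_orthogonal hip hH span_modulations_L2 span_modulationsD
    TL Vp p_min m (- s) (Vp m).
  have sqE : sqL2 muX (rho m) = rdot muX ip (rho m) T - rdot muX ip (rho m) (p m).
    by rewrite -(rdot_sqL2 muX hip) -(rdotBr hip hH TL (pL m) (rhoL m)).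
  have {almost} : s * (- rdot muX ip (rho m) (p m)) <= s * (K * s).
    have : s ^+ 2 * sqL2 muX (p m) <= s ^+ 2 * (K - 1) by rewrite ler_wpM2l// exprn_ge0// ltW.
    have : 0 <= s * (K * s) by rewrite !mulr_ge0// ltW.
    move: almost; rewrite rs sqrrN -/(rho m); lra.
  by rewrite ler_pM2l// sqE -/s; lra.
have K0' : (fun m => K * 2^-1 ^+ m) @ \oo --> (0 : R).
  rewrite -[X in _ --> X](mulr0 K); apply: cvgM; first exact: cvg_cst.
  by apply: cvg_expr; rewrite ger0_norm// invf_lt1 ?ltr1n.
have lim0 : (fun m => rdot muX ip (rho m) T + K * 2^-1 ^+ m) @ \oo --> (0 : R).
  by have := cvgD rhoT K0'; rewrite addr0; exact.
have e20 : 0 < e ^+ 2 by rewrite exprn_gt0.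
have [m _ lt_m] := cvgr_lt _ lim0 _ e20.
have hm := lt_m m (leqnn m).
exists (p m); first exact: Vp.
by rewrite (vL2_lt_L2norm hip hH (rhoL m) e0); exact: le_lt_trans (bound m) hm.
Qed.
End ParsevalDensity.

(** * Frame inequalities in one fibre *)

Section FibreAlgebra.
Variables (R : realType) (H : normedModType R[i]).
Implicit Types (A : set H) (u v : H).

Lemma closureP A u :
  closure A u <-> forall e : R, 0 < e -> exists2 v, A v & hnorm (u - v) < e.
Proof.
split=> [cAu e e0|Ae B /nbhs_ballP[e /= e0 eB]].
  have /cAu[v [Av]] : nbhs u (ball u e%:C%C) by apply: nbhsx_ballx; rewrite ltcR.
  by rewrite -ball_normE/= normHE ltcR => uv; exists v.
have eR : e = (Re e)%:C%C.
  by move: e0; rewrite ltcE => /andP[/eqP/= + _]; case: (e) => a b /= ->.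
have [|v Av uv] := Ae (Re e); first by rewrite -ltcR -eR.
by exists v; split=> //; apply: eB; rewrite -ball_normE/= normHE eR ltcR.
Qed.

Lemma closure_spanD A u v : closure (span A) u -> closure (span A) v ->
  closure (span A) (u + v).
Proof.
move=> /closureP cu /closureP cv; apply/closureP => e e0.
have e2 : 0 < e / 2 by rewrite divr_gt0.
have [u' Au uu'] := cu _ e2; have [v' Av vv'] := cv _ e2.
exists (u' + v'); first exact: spanD.
rewrite opprD addrACA (le_lt_trans (ler_hnormD _ _))// [ltRHS]splitr.
exact: ltrD.
Qed.

Lemma closure_spanZ A c u : closure (span A) u -> closure (span A) (c *: u).
Proof.
move=> /closureP cu; apply/closureP => e e0.
have c0 : 0 < normc c + 1 by rewrite ltr_wpDl ?normc_ge0.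
have [|v Av uv] := cu (e / (normc c + 1)); first by rewrite divr_gt0.
exists (c *: v); first exact: spanZ.
rewrite -scalerBr hnormZ; move: uv; rewrite ltr_pdivlMr// => uv.
apply: le_lt_trans uv; rewrite mulrC ler_wpM2l ?hnorm_ge0//.
by rewrite lerDl.
Qed.

Lemma closure_spanB A u v : closure (span A) u -> closure (span A) v ->
  closure (span A) (u - v).
Proof. by move=> cu cv; rewrite -scaleN1r; apply: closure_spanD => //; exact: closure_spanZ. Qed.

Lemma closure_span_sum A n (c : 'I_n -> R[i]) (a : 'I_n -> H) :
  (forall i, closure (span A) (a i)) -> closure (span A) (\sum_i c i *: a i).
Proof.
move=> ca; elim/big_ind : _ => [|u v|i _]; [|exact: closure_spanD|exact: closure_spanZ].
by apply: subset_closure; exact: span0.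
Qed.
End FibreAlgebra.

Section FibreInequalities.
Context (d : measure_display) (N : measurableType d) (R : realType).
Variable mu : {measure set N -> \bar R}.
Variables (H : normedModType R[i]) (ip : {dot H for Num.conj}).
Hypothesis hip : norm_induced_by ip.
Variable w : N -> H.
Hypothesis mw : weakly_measurable ip w.

Definition frame_energy (u : H) := (\int[mu]_t (normc (ip u (w t)) ^+ 2)%:E)%E.

Lemma measurable_frame_energy u : measurable_fun setT (fun t => normc (ip u (w t)) ^+ 2).
Proof.
apply: measurable_sqr_normc; under eq_fun do rewrite ipC.
exact: measurable_complex_conj.
Qed.

Lemma sqr_weighted_add (x y c : R) : 0 < c ->
  (x + y) ^+ 2 <= (1 + c) * x ^+ 2 + (1 + c^-1) * y ^+ 2.
Proof.
move=> c0; rewrite -(ler_pM2l c0).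
have := sqr_ge0 (c * x - y); rewrite sqrrB.
have -> : c * ((1 + c) * x ^+ 2 + (1 + c^-1) * y ^+ 2) =
  c * x ^+ 2 + (c * x) ^+ 2 + c * y ^+ 2 + y ^+ 2 by field; rewrite gt_eqF.
lra.
Qed.

Lemma frame_energy_subadd u v (c : R) : 0 < c ->
  (frame_energy (u + v)%R <= (1 + c)%:E * frame_energy u + (1 + c^-1)%:E * frame_energy v)%E.
Proof.
move=> c0; have c1 : 0 <= 1 + c by rewrite addr_ge0// ltW.
have c2 : 0 <= 1 + c^-1 by rewrite addr_ge0// invr_ge0 ltW.
have m z := measurable_frame_energy z.
have scale k z : 0 <= k -> (k%:E * frame_energy z =
    \int[mu]_t (k%:E * (normc (ip z (w t)) ^+ 2)%:E))%E.
  move=> k0; rewrite ge0_integralZl_EFin//; last exact/measurable_EFinP.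
  by move=> t _; rewrite lee_fin sqr_ge0.
rewrite !scale// /frame_energy -ge0_integralD//; last 4 first.
- by move=> t _; rewrite lee_fin mulr_ge0// sqr_ge0.
- by apply/measurable_EFinP/measurable_funM.
- by move=> t _; rewrite lee_fin mulr_ge0// sqr_ge0.
- by apply/measurable_EFinP/measurable_funM.
apply: ge0_le_integral => //.
- by move=> t _; rewrite lee_fin sqr_ge0.
- exact/measurable_EFinP.
- by apply/measurable_EFinP/measurable_funD; exact: measurable_funM.
move=> t _; rewrite -!EFinM -EFinD lee_fin ip_addl !normc2E addCE/=.
have := sqr_weighted_add (Re (ip u (w t))) (Re (ip v (w t))) c0.
have := sqr_weighted_add (Im (ip u (w t))) (Im (ip v (w t))) c0.
lra.
Qed.

Lemma limn_einf_le (u : nat -> \bar R) (c : \bar R) : (forall n, u n <= c)%E ->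
  (limn_einf u <= c)%E.
Proof.
move=> uc; rewrite limn_einf_lim; apply: lime_le; first exact: is_cvg_einfs.
apply: nearW => n; apply: le_trans (uc n); apply: ereal_inf_lbound.
by exists n => //=.
Qed.

Lemma cvg_sqr_normc_ip (un : nat -> H) u v : (fun n => hnorm (un n - u)) @ \oo --> (0 : R) ->
  (fun n => normc (ip (un n) v) ^+ 2) @ \oo --> normc (ip u v) ^+ 2.
Proof.
move=> unu.
have lim0 : (fun n => hnorm (un n - u) * hnorm v) @ \oo --> (0 : R).
  by rewrite -[X in _ --> X](mul0r (hnorm v)); apply: cvgM => //; exact: cvg_cst.
have lim (P : R[i] -> R) : (forall z z', P (z - z') = P z - P z') ->
    (forall z, `|P z| <= normc z) -> (fun n => P (ip (un n) v)) @ \oo --> P (ip u v).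
  move=> PB Pn; apply/cvgrPdist_le => e e0.
  move/cvgrPdist_le : lim0 => /(_ e e0); apply: filterS => n.
  rewrite sub0r normrN ger0_norm ?mulr_ge0 ?hnorm_ge0//; apply: le_trans.
  rewrite distrC -PB -ip_subl; apply: le_trans (Pn _) _; exact: cauchy_schwarz.
rewrite normc2E; under eq_fun do rewrite normc2E.
have lR := lim (@complex.Re R) (fun z w => ltac:(by rewrite addCE oppCE)) (@ler_Re_normc R).
have lI := lim (@complex.Im R) (fun z w => ltac:(by rewrite addCE oppCE)) (@ler_Im_normc R).
rewrite !expr2; apply: cvgD; exact: cvgM.
Qed.

(** Fatou's lemma. *)
Lemma frame_energy_lsc (un : nat -> H) u (c : \bar R) :
  (fun n => hnorm (un n - u)) @ \oo --> (0 : R) ->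
  (forall n, frame_energy (un n) <= c)%E -> (frame_energy u <= c)%E.
Proof.
move=> unu unc; apply: le_trans (limn_einf_le unc).
have fatou_un := @fatou _ _ _ mu setT measurableT
  (fun n t => (normc (ip (un n) (w t)) ^+ 2)%:E)
  (fun n => (measurable_EFinP _ _).2 (measurable_frame_energy (un n)))
  (fun n t _ => ltac:(by rewrite lee_fin sqr_ge0)).
apply: le_trans fatou_un; rewrite /frame_energy le_eqVlt; apply/orP; left; apply/eqP.
apply: eq_integral => t _; apply/esym.
have : (normc (ip (un n) (w t)) ^+ 2)%:E @[n --> \oo] --> (normc (ip u (w t)) ^+ 2)%:E.
  by apply: cvg_EFin; [exact: nearW|exact: cvg_sqr_normc_ip].
by move/cvg_limn_einf_sup => [].
Qed.

(** The upper bound passes to limits by lower semicontinuity.  For the lower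
    bound at [u], take [v] in [D] close to [u]: the energies of [u] and [v]
    differ little, because the energy of [v - u] is controlled by the upper
    bound, which is already known on [J]. *)
Lemma frame_inequality_closure (D J : set H) (A B : R) : 0 < A -> A <= B ->
  D `<=` J -> J `<=` closure D -> (forall u v, J u -> J v -> J (u - v)) ->
  (forall u, D u -> ((A * hnorm u ^+ 2)%:E <= frame_energy u)%E /\
                    (frame_energy u <= (B * hnorm u ^+ 2)%:E)%E) ->
  forall u, J u -> ((A * hnorm u ^+ 2)%:E <= frame_energy u)%E /\
                   (frame_energy u <= (B * hnorm u ^+ 2)%:E)%E.
Proof.
move=> A0 AB DJ JD JB Dframe.
have B0 : 0 < B by exact: lt_le_trans AB.
have upper u : J u -> (frame_energy u <= (B * hnorm u ^+ 2)%:E)%E.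
  move=> Ju; have bound eta : 0 < eta -> (frame_energy u <= (B * (hnorm u + eta) ^+ 2)%:E)%E.
    move=> eta0; have pos n : 0 < eta * 2^-1 ^+ n by rewrite mulr_gt0// exprn_gt0.
    have /choice[un hun] n : exists v, D v /\ hnorm (u - v) < eta * 2^-1 ^+ n.
      by have /closureP/(_ _ (pos n))[v Dv uv] := JD _ Ju; exists v.
    apply: (@frame_energy_lsc un).
      apply/cvgr0Pnorm_le => e e0.
      have : (fun n => eta * 2^-1 ^+ n) @ \oo --> (0 : R).
        rewrite -[X in _ --> X](mulr0 eta); apply: cvgM; first exact: cvg_cst.
        by apply: cvg_expr; rewrite ger0_norm// invf_lt1 ?ltr1n.
      move/cvgr0Pnorm_le => /(_ e e0); apply: filterS => n.
      rewrite ger0_norm ?(ltW (pos n))// ger0_norm ?hnorm_ge0//; apply: le_trans.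
      by rewrite -hnormN opprB ltW//; case: (hun n).
    move=> n; have [Dun dun] := hun n; apply: le_trans (Dframe _ Dun).2 _.
    rewrite lee_fin ler_wpM2l ?(ltW B0)//.
    rewrite ler_pXn2r ?nnegrE ?hnorm_ge0 ?addr_ge0 ?hnorm_ge0 ?(ltW eta0)//.
    have -> : un n = u - (u - un n) by rewrite opprB addrC subrK.
    rewrite (le_trans (ler_hnormD _ _))// hnormN lerD2l (le_trans (ltW dun))//.
    by rewrite ler_piMr ?(ltW eta0)// exprn_ile1// ?invr_ge0// invf_le1// ler1n.
  (* For eta <= 1, (|u| + eta)^2 - |u|^2 is at most eta (2 |u| + 1). *)
  apply/lee_addgt0Pr => e e0.
  pose C := B * (2 * hnorm u + 1).
  have C0 : 0 < C by rewrite mulr_gt0// ltr_wpDl// mulr_ge0// hnorm_ge0.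
  pose eta := Num.min 1 (e / C).
  have eta0 : 0 < eta by rewrite lt_min ltr01 divr_gt0.
  have eta1 : eta <= 1 by rewrite ge_min lexx.
  apply: le_trans (bound _ eta0) _; rewrite -EFinD lee_fin.
  have etaC : eta * C <= e by rewrite -ler_pdivlMr// ge_min lexx orbT.
  have : B * eta * eta <= B * eta * 1 by rewrite ler_wpM2l// mulr_ge0// ltW.
  by move: etaC; rewrite /C sqrrD; lra.
move=> u Ju; split; last exact: upper.
have fin : frame_energy u \is a fin_num.
  rewrite ge0_fin_numE; first exact: le_lt_trans (upper _ Ju) (ltry _).
  by apply: integral_ge0 => t _; rewrite lee_fin sqr_ge0.
have e_ge0 : 0 <= fine (frame_energy u).
  by apply: fine_ge0; apply: integral_ge0 => t _; rewrite lee_fin sqr_ge0.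
rewrite -(fineK fin) lee_fin.
set gam := fine _ in e_ge0 *.
apply/ler_addgt0Pr => e e0.
(* C eta bounds the total loss: 3 gam comes from the energy of u, 4 B from
   that of v - u, and 2 A from replacing |v| by |u|. *)
pose C := 3 * gam + 4 * B + 2 * A.
have C0 : 0 < C by rewrite /C; lra.
pose eta := Num.min 1 (e / C).
have eta0 : 0 < eta by rewrite lt_min ltr01 divr_gt0.
have eta1 : eta <= 1 by rewrite ge_min lexx.
have etaC : eta * C <= e by rewrite -ler_pdivlMr// ge_min lexx orbT.
have /closureP/(_ _ eta0)[v Dv uv] := JD _ Ju.
have vu2 : hnorm (v - u) ^+ 2 <= eta ^+ 2.
  by rewrite ler_pXn2r ?nnegrE ?hnorm_ge0 ?(ltW eta0)// -hnormN opprB ltW.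
have Gv : A * hnorm v ^+ 2 <= (1 + eta) * gam + (1 + eta^-1) * (B * eta ^+ 2).
  rewrite -lee_fin; apply: le_trans (Dframe _ Dv).1 _.
  have -> : v = u + (v - u) by rewrite addrC subrK.
  apply: le_trans (frame_energy_subadd _ _ eta0) _.
  have -> : ((1 + eta) * gam + (1 + eta^-1) * (B * eta ^+ 2))%:E =
    ((1 + eta)%:E * frame_energy u + (1 + eta^-1)%:E * (B * eta ^+ 2)%:E)%E.
    by rewrite -(fineK fin).
  apply: leeD => //.
  rewrite lee_wpmul2l ?lee_fin ?addr_ge0 ?invr_ge0 ?(ltW eta0)//.
  apply: le_trans (upper _ (JB _ _ (DJ _ Dv) Ju)) _.
  by rewrite lee_fin ler_wpM2l// ltW.
have Gu : hnorm u ^+ 2 <= (1 + eta) * hnorm v ^+ 2 + (1 + eta^-1) * eta ^+ 2.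
  apply: (@le_trans _ _ ((hnorm v + eta) ^+ 2)); last exact: sqr_weighted_add.
  rewrite ler_pXn2r ?nnegrE ?hnorm_ge0 ?addr_ge0 ?hnorm_ge0 ?(ltW eta0)//.
  have -> : u = v + (u - v) by rewrite addrC subrK.
  by rewrite (le_trans (ler_hnormD _ _))// lerD2l ltW.
have ie : (1 + eta^-1) * eta ^+ 2 = eta ^+ 2 + eta by field; rewrite gt_eqF.
have ie' : (1 + eta^-1) * (B * eta ^+ 2) = B * (eta ^+ 2 + eta) by rewrite -ie; ring.
rewrite ie in Gu; rewrite ie' in Gv.
have e2 : eta ^+ 2 <= eta by rewrite expr2 ler_piMr// ltW.
have h1 : A * hnorm u ^+ 2 <= A * ((1 + eta) * hnorm v ^+ 2 + (eta ^+ 2 + eta)).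
  by rewrite ler_wpM2l// ltW.
have h2 : (1 + eta) * (A * hnorm v ^+ 2) <=
    (1 + eta) * ((1 + eta) * gam + B * (eta ^+ 2 + eta)).
  by rewrite ler_wpM2l// addr_ge0// ltW.
have h3 : A * (eta ^+ 2 + eta) <= A * (2 * eta) by rewrite ler_wpM2l ?(ltW A0)//; lra.
have h4 : (1 + eta) * ((1 + eta) * gam + B * (eta ^+ 2 + eta)) <=
   gam + 3 * eta * gam + 4 * eta * B.
  have g1 : eta ^+ 2 * gam <= eta * gam by rewrite ler_wpM2r.
  have g2 : B * (eta ^+ 2 + eta) <= B * (2 * eta) by rewrite ler_wpM2l ?(ltW B0)//; lra.
  have g3 : (1 + eta) * (B * (eta ^+ 2 + eta)) <= 2 * (B * (2 * eta)).
    apply: ler_pM => //; [by rewrite addr_ge0// ltW| |lra].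
    by rewrite mulr_ge0 ?(ltW B0)// addr_ge0 ?(ltW eta0)// sqr_ge0.
  lra.
move: etaC; rewrite /C; lra.
Qed.
End FibreInequalities.

(** * Joint measurability of the coefficients *)

Section JointMeasurability.
Context (dX dM dN : measure_display).
Context (X : measurableType dX) (M : measurableType dM) (N : measurableType dN).
Context (R : realType).
Variable mu : {sigma_finite_measure set X -> \bar R}.
Variable k : M -> X -> R.
Hypothesis mk : forall s, measurable_fun setT (k s).
Hypothesis bk : forall s, ae_bounded mu (k s).
Hypothesis kint : forall f : X -> R, Rintegrable mu f ->
  measurable_fun setT (fun s => \int[mu]_x (k s x * f x)).
Implicit Types f h : N * X -> R.

Definition sections_integrable f := measurable_fun setT f /\
  forall t, Rintegrable mu (fun x => f (t, x)).

(** The functions [k s] depend on [s] only through the measurability of their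
    pairings with fixed functions, so [(s, x) |-> k s x] need not be measurable.
    All joint measurability has to come from [f]: products of indicators are
    treated by hand, and the rest follows by a Dynkin argument and by dominated
    convergence. *)
Definition jointly_measurable_pairing f := measurable_fun setT
  (fun p : M * N => \int[mu]_x (k p.1 x * f (p.2, x))).

Lemma sections_integrable_dominated f h : measurable_fun setT f ->
  sections_integrable h -> (forall p, `|f p| <= `|h p|) -> sections_integrable f.
Proof.
move=> mf [mh hi] fh; split=> // t.
apply: (Rintegrable_dominated _ (Rintegrable_norm (hi t))) => [|x]; last exact: fh.
exact: (measurableT_comp mf (pair1_measurable t)).
Qed.

(** Dominated convergence for each fixed pair [(s, t)]; [h] is the dominating
    function. *)
Lemma pairing_cvg (fn : nat -> N * X -> R) f h : sections_integrable h ->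
  (forall n, measurable_fun setT (fn n)) -> (forall n p, `|fn n p| <= `|h p|) ->
  (forall p, fn ^~ p @ \oo --> f p) ->
  (forall n, jointly_measurable_pairing (fn n)) -> jointly_measurable_pairing f.
Proof.
move=> hs mfn fnh fnf pfn.
apply: (@measurable_fun_cvg _ _ _ setT _ _ pfn) => -[s t] _ /=.
have fns n : sections_integrable (fn n).
  by apply: (sections_integrable_dominated _ hs) => //; exact: fnh.
have mf : measurable_fun setT f by exact: (measurable_fun_cvg mfn (fun p _ => fnf p)).
have mkf n : measurable_fun setT (fun x => (k s x * fn n (t, x))%:E).
  by apply/measurable_EFinP/measurable_funM => //; exact: (measurable_Rintegrable ((fns n).2 t)).
have mkf' : measurable_fun setT (fun x => (k s x * f (t, x))%:E).
  apply/measurable_EFinP/measurable_funM => //.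
  exact: (measurableT_comp mf (pair1_measurable t)).
have khi : Rintegrable mu (fun x => `|k s x * h (t, x)|).
  by apply: Rintegrable_norm; apply: Rintegrable_bounded_mul => //; exact: hs.2.
have cvgk : forall x, setT x ->
    (k s x * fn n (t, x))%:E @[n --> \oo] --> (k s x * f (t, x))%:E.
  move=> x _; apply: cvg_EFin; first exact: nearW.
  by apply: cvgM; [exact: cvg_cst|exact: fnf].
have kdom : forall x n, setT x ->
    (`|(k s x * fn n (t, x))%:E| <= (`|k s x * h (t, x)|)%:E)%E.
  by move=> x n _; rewrite lee_fin !normrM ler_wpM2l.
have [kfi _ lim] := dominated_convergence measurableT mkf mkf' (aeW _ cvgk) khi (aeW _ kdom).
by move: lim; rewrite (fin_integral kfi); exact: fine_cvg.
Qed.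

Lemma pairingD f h : sections_integrable f -> sections_integrable h ->
  jointly_measurable_pairing f -> jointly_measurable_pairing h ->
  jointly_measurable_pairing (fun p => f p + h p).
Proof.
move=> [mf fi] [mh hi] pf ph; rewrite /jointly_measurable_pairing.
under eq_fun => p.
  under eq_Rintegral do rewrite mulrDr.
  rewrite RintegralD//; [|exact: Rintegrable_bounded_mul..].
  over.
exact: measurable_funD.
Qed.

Lemma pairingZ f c : sections_integrable f -> jointly_measurable_pairing f ->
  jointly_measurable_pairing (fun p => c * f p).
Proof.
move=> [mf fi] pf; rewrite /jointly_measurable_pairing.
under eq_fun => p.
  under eq_Rintegral do rewrite mulrCA.
  rewrite RintegralZl//; last exact: Rintegrable_bounded_mul.
  over.
exact: measurable_funM.
Qed.

Lemma sections_integrableD f h : sections_integrable f -> sections_integrable h ->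
  sections_integrable (fun p => f p + h p).
Proof.
by move=> [mf fi] [mh hi]; split=> [|t]; [exact: measurable_funD|exact: RintegrableD].
Qed.

Lemma sections_integrableZ f c : sections_integrable f ->
  sections_integrable (fun p => c * f p).
Proof. by move=> [mf fi]; split=> [|t]; [exact: measurable_funM|exact: RintegrableZ]. Qed.

Lemma pairing_sum n (F : 'I_n -> N * X -> R) : (forall i, sections_integrable (F i)) ->
  (forall i, jointly_measurable_pairing (F i)) ->
  jointly_measurable_pairing (fun p => \sum_i F i p).
Proof.
move=> Fs Fp; suff [] : sections_integrable (fun p => \sum_i F i p) /\
  jointly_measurable_pairing (fun p => \sum_i F i p) by [].
elim: n F Fs Fp => [F _ _|n ih F Fs Fp].
  under eq_fun do rewrite big_ord0; split; first by split=> // t; exact: integrable0.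
  rewrite /jointly_measurable_pairing; under eq_fun => p.
    under eq_Rintegral do rewrite mulr0.
    over.
  exact: measurable_cst.
under eq_fun do rewrite big_ord_recr/=.
have [Ss Sp] := ih (fun i => F (widen_ord (leqnSn n) i)) (fun i => Fs _) (fun i => Fp _).
by split; [exact: sections_integrableD|exact: pairingD].
Qed.

(** Restricting to a slab [N * F] with [F] of finite measure keeps the sections
    integrable. *)
Definition slab_indic (F : set X) (E : set (N * X)) (p : N * X) : R := \1_E p * \1_F p.2.

Section Indicators.
Variable F : set X.
Hypothesis mF : measurable F.
Hypothesis finF : (mu F < +oo)%E.

Let Rint_indic B : measurable B -> Rintegrable mu (\1_(B `&` F) : X -> R).
Proof.
move=> mB; apply: Rintegrable_ge0 => //.
- by apply: measurable_indic; exact: measurableI.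
- rewrite integral_indic ?setIT//; last exact: measurableI.
  apply: le_lt_trans finF; apply: le_measure; rewrite ?inE//.
  exact: measurableI.
Qed.

Local Notation ind := (slab_indic F).

Let mind E : measurable E -> measurable_fun setT (ind E).
Proof.
move=> mE; apply: measurable_funM; first exact: measurable_indic.
by apply: measurableT_comp; [exact: measurable_indic|exact: measurable_snd].
Qed.

Let sections_F : sections_integrable (ind setT).
Proof.
split=> [|t]; first exact: mind.
have := Rint_indic measurableT; apply: eq_integrable => // x _.
by rewrite /= setTI /slab_indic indicT mul1r.
Qed.

Let ind_le E p : `|ind E p| <= `|ind setT p|.
Proof.
by rewrite /slab_indic !normrM ler_wpM2r// !indicE in_setT; case: (_ \in _); rewrite ?normr0.
Qed.

Lemma sections_integrable_slab E : measurable E -> sections_integrable (ind E).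
Proof.
move=> mE; apply: sections_integrable_dominated sections_F _; first exact: mind.
exact: ind_le.
Qed.

Lemma pairing_indic E : measurable E -> jointly_measurable_pairing (ind E).
Proof.
have rect A B : measurable A -> measurable B -> jointly_measurable_pairing (ind (A `*` B)).
  move=> mA mB; rewrite /jointly_measurable_pairing.
  have pairE p : \int[mu]_x (k p.1 x * ind (A `*` B) (p.2, x)) =
     \1_A p.2 * \int[mu]_x (k p.1 x * \1_(B `&` F) x).
    rewrite -RintegralZl//; last by apply: Rintegrable_bounded_mul => //; exact: Rint_indic.
    apply: eq_Rintegral => x _; rewrite /slab_indic.
    have -> : \1_(A `*` B) (p.2, x) = \1_A p.2 * \1_B x :> R.
      by rewrite !indicE in_setX/= -natrM mulnb.
    by rewrite indicI/=; ring.
  under eq_fun do rewrite pairE.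
  apply: measurable_funM.
    by apply: measurableT_comp; [exact: measurable_indic|exact: measurable_snd].
  apply: (measurableT_comp (kint (Rint_indic mB))); exact: measurable_fst.
have indC S : ind (~` S) = fun p => ind setT p + (-1) * ind S p.
  apply/funext => p; rewrite /slab_indic !indicE in_setC in_setT.
  by case: (_ \in _) => /=; ring.
pose G := [set A `*` B | A in @measurable _ N & B in @measurable _ X].
have GE : (dN, dX).-prod.-measurable = <<s G >> by exact: measurable_prod_measurableType.
have GI : setI_closed G.
  move=> _ _ [A1 mA1 [B1 mB1 <-]] [A2 mA2 [B2 mB2 <-]].
  rewrite -setXI; exists (A1 `&` A2); first exact: measurableI.
  by exists (B1 `&` B2) => //; exact: measurableI.
move=> mE; have : <<s G >> E by rewrite -GE.
have count (Fn : (set (N * X))^nat) n p j : trivIset setT Fn -> Fn j p ->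
    \sum_(i < n) ind (Fn i) p = (j < n)%N%:R * \1_F p.2.
  move=> tF Fj; rewrite -mulr_suml; congr (_ * _).
  elim: n => [|n ih]; first by rewrite big_ord0.
  rewrite big_ord_recr/= ih indicE [in RHS]ltnS [in RHS]leq_eqVlt.
  have [jn|jn] := eqVneq j n; first by rewrite -jn ltnn add0r mem_set.
  rewrite memNset ?addr0// => Fnp; move: jn => /eqP; apply.
  by apply: tF => //; exists p.
have count0 (Fn : (set (N * X))^nat) n p : ~ (\bigcup_i Fn i) p ->
    \sum_(i < n) ind (Fn i) p = 0.
  move=> nF; rewrite big1// => i _; rewrite /slab_indic indicE memNset ?mul0r// => Fi.
  by apply: nF; exists i.
apply: (@dynkin_induction _ _ G (fun E => jointly_measurable_pairing (ind E)) GE GI) =>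
  [|_ [A mA [B mB <-]]|S mS pS|Fn mFn tF pF].
- by rewrite -setXTT; exact: rect.
- exact: rect.
- rewrite indC; apply: pairingD => //.
    exact: sections_integrableZ (sections_integrable_slab mS).
    by rewrite -setXTT; exact: rect.
  by apply: pairingZ => //; exact: sections_integrable_slab.
- apply: (@pairing_cvg (fun n p => \sum_(i < n) ind (Fn i) p) _ _ sections_F).
  + by move=> n; apply: measurable_sum => i; exact: mind.
  + move=> n p; have [[j _ Fj]|nF] := pselect ((\bigcup_i Fn i) p).
      rewrite (count _ _ _ _ tF Fj) /slab_indic !normrM ler_wpM2r// indicT.
      by case: (_ < _)%N; rewrite ?normr0.
    by rewrite count0// normr0.
  + move=> p; have [[j _ Fj]|nF] := pselect ((\bigcup_i Fn i) p).
      under eq_fun do rewrite (count _ _ _ _ tF Fj).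
      rewrite /slab_indic indicE mem_set//; last by exists j.
      apply: cvg_near_cst; exists j.+1 => // n /= jn; by rewrite jn.
    under eq_fun do rewrite count0//.
    by rewrite /slab_indic indicE memNset// mul0r; exact: cvg_cst.
  + by move=> n; apply: pairing_sum => i; [exact: sections_integrable_slab|exact: pF].
Qed.
End Indicators.
Import HBNNSimple.

Lemma pairing_nnsfun F (s : {nnsfun (N * X) >-> R}) : measurable F -> (mu F < +oo)%E ->
  jointly_measurable_pairing (fun p => s p * \1_F p.2).
Proof.
move=> mF finF; pose c := finmap.enum_fset (fset_set (s @` setT)).
rewrite (_ : (fun p => _) = fun p => \sum_(i < size c)
    (c`_i * slab_indic F (s @^-1` [set c`_i]) p)).
  apply: pairing_sum => i.
    by apply: sections_integrableZ; exact: sections_integrable_slab.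
  by apply: pairingZ; [exact: sections_integrable_slab|exact: pairing_indic].
by apply/funext => p; rewrite (fimfunEord s) mulr_suml; apply: eq_bigr => i _; rewrite mulrA.
Qed.

Lemma pairing_ge0 f : sections_integrable f -> (forall p, 0 <= f p) ->
  jointly_measurable_pairing f.
Proof.
move=> fs f0; have mf : measurable_fun setT (EFin \o f) by apply/measurable_EFinP; exact: fs.1.
have /sigma_finiteP[F [F_T F_nd mF]] := sigma_finiteT mu.
pose s n := nnsfun_approx measurableT mf n.
apply: (@pairing_cvg (fun n p => s n p * \1_(F n) p.2) _ _ fs).
- move=> n; apply: measurable_funM => //.
  apply: measurableT_comp; last exact: measurable_snd.
  by apply: measurable_indic; case: (mF n).
- move=> n p; have sf : s n p <= f p.
    by rewrite -lee_fin /s nnsfun_approxE; apply: le_approx => // q _; rewrite lee_fin.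
  rewrite (ger0_norm (f0 p)) normrM ger0_norm// (le_trans _ sf)// ler_piMr//.
  by rewrite indicE; case: (_ \in _); rewrite ?normr0 ?normr1.
- move=> p; have sp : s n p @[n --> \oo] --> f p.
    apply: (@fine_cvg _ _ _ _ (fun n => (s n p)%:E)).
    by apply: cvg_nnsfun_approx => // q _; rewrite lee_fin.
  rewrite -[f p]mulr1; apply: cvgM => //; apply: cvg_near_cst.
  have [n _ Fn] : (\bigcup_i F i) p.2 by rewrite -F_T.
  exists n => // m /= nm; rewrite indicE mem_set//.
  by have /subsetPset := F_nd _ _ nm; apply.
- by move=> n; have [mFn finFn] := mF n; exact: pairing_nnsfun.
Qed.

Lemma measurable_pairing f : sections_integrable f -> jointly_measurable_pairing f.
Proof.
move=> fs; have mf := fs.1.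
have mp : measurable_fun setT (fun p => Num.max (f p) 0) by exact: measurable_maxr.
have mn : measurable_fun setT (fun p => Num.max (- f p) 0).
  by apply: measurable_maxr => //; exact: measurable_funN.
have ps : sections_integrable (fun p => Num.max (f p) 0).
  apply: (sections_integrable_dominated mp fs) => p.
  by rewrite ger0_norm ?le_max ?lexx ?orbT// ge_max normr_ge0 ler_norm.
have ns : sections_integrable (fun p => Num.max (- f p) 0).
  apply: (sections_integrable_dominated mn fs) => p.
  by rewrite ger0_norm ?le_max ?lexx ?orbT// ge_max normr_ge0 -normrN ler_norm.
rewrite (_ : f = fun p => Num.max (f p) 0 + (-1) * Num.max (- f p) 0).
  apply: pairingD => //; first exact: sections_integrableZ.
    by apply: pairing_ge0 => // p; rewrite le_max lexx orbT.
  apply: pairingZ => //; apply: pairing_ge0 => // p; by rewrite le_max lexx orbT.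
by apply/funext => p; rewrite mulN1r !maxEle oppr_le0; case: (ltrgtP (f p) 0) => h; lra.
Qed.
End JointMeasurability.

(** * Fibres of L2 closures *)

Section FibreMembership.
Context (d : measure_display) (X : measurableType d) (R : realType).
Variables (mu : {measure set X -> \bar R}).
Variables (H : normedModType R[i]) (ip : {dot H for Num.conj}).
Hypothesis hip : norm_induced_by ip.
Hypothesis hH : separable H.
Let vL2 := vector_L2 mu ip.

Lemma vector_L2_ae_eq f h : weakly_measurable ip h -> vL2 f ->
  (\forall x \ae mu, h x = f x) -> vL2 h.
Proof.
move=> mh fL hf; split=> //; rewrite L2normE.
rewrite (@ae_eq_integralT _ _ _ mu _ (fun x => (hnorm (f x) ^+ 2)%:E)).
  by rewrite -L2normE; case: fL.
by apply: filterS hf => x ->.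
Qed.

(** Choose [h n] in [F] converging to [f] in L2.  The infimum over [n] of
    [|f - h n|^2] has integral zero, so almost everywhere it vanishes and [f x]
    adheres to the values [h n x].  No subsequence has to be extracted. *)
Lemma L2closure_fibre (F : set (X -> H)) (J : X -> set H) f : F `<=` vL2 ->
  (forall x, closed (J x)) -> (forall h, F h -> \forall x \ae mu, J x (h x)) ->
  L2closure mu ip F f -> \forall x \ae mu, J x (f x).
Proof.
move=> FL2 Jclosed FJ [fL fcl].
have pos n : 0 < n.+1%:R^-1 :> R by rewrite invr_gt0.
have /choice[h hh] n : exists h, F h /\ (L2norm mu (f \- h)%R < n.+1%:R^-1%:E)%E.
  by have [h Fh fh] := fcl _ (pos n); exists h.
have dL n : vL2 (fun x => f x - h n x) by apply: vector_L2B => //; apply: FL2; case: (hh n).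
pose D n x := (hnorm (f x - h n x) ^+ 2)%:E.
have mD n : measurable_fun setT (D n).
  by apply/measurable_EFinP/(measurable_Rintegrable (mu := mu)); have /vector_L2P[] := dL n.
pose I x := einfs (D ^~ x) 0.
have mI : measurable_fun setT I by exact: measurable_fun_einfs.
have I0 x : (0 <= I x)%E.
  by apply: le_ereal_inf_tmp => _ [n _ <-]; rewrite lee_fin sqr_ge0.
have ID n x : (I x <= D n x)%E by apply: ereal_inf_lbound; exists n.
have intI : (\int[mu]_x `|I x| = 0)%E.
  under eq_integral do rewrite gee0_abs//.
  apply/eqP; rewrite eq_le integral_ge0// andbT; apply/lee_addgt0Pr => e e0.
  rewrite add0e.
  have [n _ lt_n] := near_infty_natSinv_lt (PosNum e0).
  have {lt_n} /= ne := lt_n n (leqnn n).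
  apply: (@le_trans _ _ (\int[mu]_x D n x)%E).
    by apply: ge0_le_integral => // x _; rewrite lee_fin sqr_ge0.
  have := (hh n).2; rewrite lt_L2norm// => /ltW/le_trans; apply.
  rewrite lee_fin (le_trans _ (ltW ne))// expr2 ler_piMr ?(ltW (pos n))//.
  by rewrite invf_le1// ler1n.
have Jh : \forall x \ae mu, forall n, J x (h n x).
  by apply: ae_foralln => n; apply: FJ; case: (hh n).
have Iae : \forall x \ae mu, I x = 0%E.
  by move/(ae_eq_integral_abs mu measurableT mI) : intI; apply: filterS => x; apply.
apply: filterS (filterI Jh Iae) => x [Jhx Ix0].
have /closure_id -> := Jclosed x; apply/closureP => e e0.
have : (I x < (e ^+ 2)%:E)%E by rewrite Ix0 lte_fin exprn_gt0.
move=> /ereal_inf_lt[_ [n _ <-]]; rewrite lte_fin => dn.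
exists (h n x) => //.
by move: dn; rewrite ltr_pXn2r// ?nnegrE ?hnorm_ge0 ?ltW.
Qed.
End FibreMembership.

Section CountableSpan.
Variables (R : realType) (T : Type) (H : normedModType R[i]) (e : nat -> T -> H).

(** Coefficients with rational real and imaginary parts, so that there are only
    countably many combinations to test. *)
Definition gauss (q : rat * rat) : R[i] := Complex (ratr q.1) (ratr q.2).

Definition rational_combination (l : seq (nat * (rat * rat))) (x : T) : H :=
  \sum_(q <- l) gauss q.2 *: e q.1 x.

Lemma rational_combination_span l x :
  span (range (e ^~ x)) (rational_combination l x).
Proof.
rewrite /rational_combination; elim/big_ind : _ => [|u v|q _]; [exact: span0|exact: spanD|].
by apply: spanZ; apply: mem_span; exists q.1.
Qed.

Lemma gauss_dense (c : R[i]) (r : R) : 0 < r -> exists q, normc (c - gauss q) < r.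
Proof.
move=> r0; have r2 : 0 < r / 2 by rewrite divr_gt0.
have approx (a : R) : exists q : rat, `|a - ratr q| < r / 2.
  have [|q] := @rat_in_itvoo R (a - r / 2) (a + r / 2); first by lra.
  rewrite in_itv/= => /andP[h1 h2]; exists q; rewrite ltr_norml; lra.
have [p hp] := approx (Re c); have [q hq] := approx (Im c); exists (p, q).
have : normc (c - gauss (p, q)) <= `|Re c - ratr p| + `|Im c - ratr q|.
  rewrite -(@ler_pXn2r _ 2)// ?nnegrE ?normc_ge0 ?addr_ge0//.
  rewrite normc2E oppCE addCE/= [leRHS]sqrrD !real_normK ?num_real//.
  by rewrite lerD2r lerDl mulrn_wge0// mulr_ge0.
by move/le_lt_trans; apply; rewrite [ltRHS]splitr ltrD.
Qed.

Lemma rational_combination_dense x :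
  closure (span (range (e ^~ x))) `<=` closure (range (rational_combination ^~ x)).
Proof.
set D := range _; set W := closure (range _).
have W0 : W 0.
  by apply: subset_closure; exists [::] => //; rewrite /rational_combination big_nil.
have WD u v : W u -> W v -> W (u + v).
  move=> /closureP Wu /closureP Wv; apply/closureP => r r0.
  have r2 : 0 < r / 2 by rewrite divr_gt0.
  have [_ [l _ <-] ul] := Wu _ r2; have [_ [m _ <-] vm] := Wv _ r2.
  exists (rational_combination (l ++ m) x); first by exists (l ++ m).
  rewrite /rational_combination big_cat/= opprD addrACA.
  by rewrite (le_lt_trans (ler_hnormD _ _))// [ltRHS]splitr ltrD.
have WZ c n : W (c *: e n x).
  apply/closureP => r r0.
  have e1 : 0 < hnorm (e n x) + 1 by rewrite ltr_wpDl ?hnorm_ge0.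
  have [|q cq] := @gauss_dense c (r / (hnorm (e n x) + 1)); first by rewrite divr_gt0.
  exists (rational_combination [:: (n, q)] x); first by exists [:: (n, q)].
  rewrite /rational_combination big_seq1/= -scalerBl hnormZ.
  move: cq; rewrite ltr_pdivlMr//; apply: le_lt_trans.
  by rewrite ler_wpM2l ?normc_ge0// lerDl.
have spanW : span D `<=` W.
  move=> _ [n [c [a [Da ->]]]]; elim/big_ind : _ => // i _.
  by have [k _ <-] := Da i.
have /closure_id -> : closed W by exact: closed_closure.
exact: closureS.
Qed.
End CountableSpan.

(** * The energy of the coefficients as an integral over the fibres *)

Section FrameFibres.
Context (R : realType) (dX dM dN : measure_display).
Context (X : measurableType dX) (M : measurableType dM) (N : measurableType dN).
Variables (muX : {sigma_finite_measure set X -> \bar R}).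
Variables (muM : {sigma_finite_measure set M -> \bar R}).
Variables (muN : {sigma_finite_measure set N -> \bar R}).
Variable g : M -> X -> R[i].
Hypothesis hg : parseval_determining muX muM g.
Variables (H : normedModType R[i]) (ip : {dot H for Num.conj}).
Hypothesis hip : norm_induced_by ip.
Hypothesis hH : separable H.
Variables (phi Phi : N -> X -> H).
Hypothesis hphi : forall t, vector_L2 muX ip (phi t).
Hypothesis hPhi : joint_representative muN muX ip phi Phi.
Let vL2 := vector_L2 muX ip.

Lemma weakly_measurable_Phi_l t : weakly_measurable ip (Phi t).
Proof. by move=> u; exact: (measurable_complex_comp (pair1_measurable t) (hPhi.2 u)). Qed.

Lemma weakly_measurable_Phi_r x : weakly_measurable ip (Phi ^~ x).
Proof. by move=> u; exact: (measurable_complex_comp (pair2_measurable x) (hPhi.2 u)). Qed.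

Lemma Phi_L2 : \forall t \ae muN, vL2 (Phi t).
Proof.
apply: filterS hPhi.1 => t Phit; apply: vector_L2_ae_eq Phit => //.
exact: weakly_measurable_Phi_l.
Qed.

Variable psi : X -> H.
Hypothesis psiL : vL2 psi.

Let f (p : N * X) : R[i] := ip (psi p.2) (Phi p.1 p.2).

Lemma measurable_coefficient : measurable_complex f.
Proof.
apply: (measurable_ip hip hH (f := fun p : N * X => psi p.2)
  (h := fun p => Phi p.1 p.2)); last exact: hPhi.2.
by move=> u; exact: (measurable_complex_comp measurable_snd (psiL.1 u)).
Qed.

Lemma ip_modulation (c : R[i]) (u v : H) : ip u (c *: v) = ip u v * Num.conj c.
Proof. by rewrite ip_scaler mulrC. Qed.

Lemma parseval_Phi t : vL2 (Phi t) ->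
  (\int[muM]_s (normc (cintegral muX (fun x => ip (psi x) (g s x *: Phi t x))) ^+ 2)%:E =
   \int[muX]_x (normc (f (t, x)) ^+ 2)%:E)%E.
Proof.
move=> tL; have [fR fI] := integrable_ip hip hH psiL tL.
have [_ <-] := hg.2 _ (complex_L1 fR fI).
apply: eq_integral => s _; congr (normc (cintegral _ _) ^+ 2)%:E.
by apply/funext => x; rewrite ip_modulation.
Qed.

Lemma measurable_sqr_coefficient :
  measurable_fun setT (fun p => (normc (f p) ^+ 2)%:E).
Proof. by apply/measurable_EFinP; exact: (measurable_sqr_normc measurable_coefficient). Qed.

Lemma measurable_fibre_energy :
  measurable_fun setT (fun x => frame_energy muN ip (Phi ^~ x) (psi x)).
Proof.
apply: (measurable_fun_fubini_tonelli_G _ measurable_sqr_coefficient) => p.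
by rewrite lee_fin sqr_ge0.
Qed.

(** Parseval in the variable [s], for almost every [t], and then Tonelli. *)
Lemma iterated_energy :
  (\int[muN]_t \int[muM]_s
     (normc (cintegral muX (fun x => ip (psi x) (g s x *: Phi t x))) ^+ 2)%:E =
   \int[muX]_x frame_energy muN ip (Phi ^~ x) (psi x))%E.
Proof.
rewrite (@ae_eq_integralT _ _ _ muN _ (fun t => \int[muX]_x (normc (f (t, x)) ^+ 2)%:E)%E).
  apply: (fubini_tonelli _ measurable_sqr_coefficient) => p; by rewrite lee_fin sqr_ge0.
by apply: filterS Phi_L2 => t; exact: parseval_Phi.
Qed.

Lemma ae_pairing : \forall t \ae muN, forall s,
  L2inner muX ip psi (fun x => g s x *: phi t x) =
  cintegral muX (fun x => ip (psi x) (g s x *: Phi t x)).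
Proof.
apply: filterS hPhi.1 => t Phit s; rewrite /L2inner /cintegral /Rintegral.
by congr (Complex (fine _) (fine _)); apply: ae_eq_integralT; apply: filterS Phit => x ->.
Qed.

(** Tonelli for a measurable representative of the coefficients; the iterated
    integrals do not see the null set where the representative differs. *)
Lemma product_energy :
  ae_measurable_complex (muM \x muN)%E
    (fun p => L2inner muX ip psi (fun x => g p.1 x *: phi p.2 x)) ->
  (\int[muM \x muN]_p
     (normc (L2inner muX ip psi (fun x => g p.1 x *: phi p.2 x)) ^+ 2)%:E =
   \int[muX]_x frame_energy muN ip (Phi ^~ x) (psi x))%E.
Proof.
move=> [h mh hE].
rewrite (@ae_eq_integralT _ _ _ (muM \x muN)%E _ (fun p => (normc (h p) ^+ 2)%:E)); last first.
  by apply: filterS hE => p ->.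
rewrite fubini_tonelli2; last 2 first.
- by apply/measurable_EFinP; exact: measurable_sqr_normc.
- by move=> p; rewrite lee_fin sqr_ge0.
rewrite -iterated_energy; apply: ae_eq_integralT.
apply: filterS (filterI (ae_ysection hE) ae_pairing) => t [ht pt].
by apply: ae_eq_integralT; apply: filterS ht => s <-; rewrite pt.
Qed.

Lemma ae_snd (Q : N -> Prop) : (\forall t \ae muN, Q t) ->
  \forall p \ae (muM \x muN)%E, Q p.2.
Proof.
move=> [E [mE E0 QE]]; exists (setT `*` E); split.
- exact: measurableX.
- by rewrite product_measure1E// E0 mule0.
- by move=> p /= nQ; split=> //; exact: QE.
Qed.

(** Cut the coefficient function off outside the indices [t] for which its
    section is integrable, and split it into real and imaginary parts: four
    pairings to which [measurable_pairing] applies. *)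
Lemma ae_measurable_pairing :
  ae_measurable_complex (muM \x muN)%E
    (fun p => L2inner muX ip psi (fun x => g p.1 x *: phi p.2 x)).
Proof.
have [mfR mfI] := measurable_coefficient.
pose q p := `|Re (f p)| + `|Im (f p)|.
have mq : measurable_fun setT q by apply: measurable_funD; exact: measurableT_comp.
have q0 p : 0 <= q p by rewrite addr_ge0.
pose T0 := [set t | \int[muX]_x (q (t, x))%:E < +oo]%E.
have mT0 : measurable T0.
  rewrite -[T0]setTI; apply: emeasurable_fun_infty_o => //.
  apply: (measurable_fun_fubini_tonelli_F _ ((measurable_EFinP _ _).2 mq)) => p.
  by rewrite lee_fin.
have mtrunc (P : R[i] -> R) : measurable_fun setT (fun p => P (f p)) ->
    measurable_fun setT (fun p : N * X => \1_T0 p.1 * P (f p)).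
  move=> mP; apply: measurable_funM => //.
  by apply: measurableT_comp; [exact: measurable_indic|exact: measurable_fst].
have strunc (P : R[i] -> R) : measurable_fun setT (fun p => P (f p)) ->
    (forall p, `|P (f p)| <= q p) ->
    sections_integrable muX (fun p : N * X => \1_T0 p.1 * P (f p)).
  move=> mP Pq; split=> [|t]; first exact: mtrunc.
  have [tT|tT] := pselect (T0 t); last first.
    have -> : (fun x => \1_T0 (t, x).1 * P (f (t, x))) = (fun=> 0).
      by apply/funext => x; rewrite indicE memNset// mul0r.
    exact: integrable0.
  have qi : Rintegrable muX (fun x => q (t, x)).
    by apply: Rintegrable_ge0 => //; exact: (measurableT_comp mq (pair1_measurable t)).
  apply: (Rintegrable_dominated _ qi) => [|x].
    exact: (measurableT_comp (mtrunc P mP) (pair1_measurable t)).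
  by rewrite indicE mem_set// mul1r; exact: Pq.
have sR : sections_integrable muX (fun p : N * X => \1_T0 p.1 * Re (f p)).
  by apply: (strunc (@complex.Re R)) => // p; rewrite lerDl.
have sI : sections_integrable muX (fun p : N * X => \1_T0 p.1 * Im (f p)).
  by apply: (strunc (@complex.Im R)) => // p; rewrite lerDr.
have coefR (v : X -> R) : Rintegrable muX v ->
    measurable_complex (fun s => cintegral muX (fun x => (v x)%:C%C * Num.conj (g s x))).
  move=> vi; have [] := hg.2 (fun x => (v x)%:C%C) _ => //.
  by apply: complex_L1 => //=; exact: integrable0.
have gR s : measurable_fun setT (fun x => Re (g s x)) /\ ae_bounded muX (fun x => Re (g s x)).
  have [[mg _] [C gC]] := Linfty_bounded (hg.1 s); split=> //; exists C.
  by apply: filterS gC => x; apply: le_trans; exact: ler_Re_normc.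
have gI s : measurable_fun setT (fun x => Im (g s x)) /\ ae_bounded muX (fun x => Im (g s x)).
  have [[_ mg] [C gC]] := Linfty_bounded (hg.1 s); split=> //; exists C.
  by apply: filterS gC => x; apply: le_trans; exact: ler_Im_normc.
have kR (v : X -> R) : Rintegrable muX v ->
    measurable_fun setT (fun s => \int[muX]_x (Re (g s x) * v x)).
  move=> vi; have [mv _] := coefR v vi; apply: eq_measurable_fun mv => s _ /=.
  by apply: eq_Rintegral => x _; rewrite conjCE mulCE/=; ring.
have kI (v : X -> R) : Rintegrable muX v ->
    measurable_fun setT (fun s => \int[muX]_x (Im (g s x) * v x)).
  move=> vi; have nvi : Rintegrable muX (fun x => - v x).
    by have := RintegrableZ (-1) vi; under eq_fun do rewrite mulN1r.
  have [_ mv] := coefR _ nvi; apply: eq_measurable_fun mv => s _ /=.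
  by apply: eq_Rintegral => x _; rewrite conjCE mulCE/=; ring.
pose pair (k : M -> X -> R) (P : R[i] -> R) (p : M * N) :=
  \int[muX]_x (k p.1 x * (\1_T0 p.2 * P (f (p.2, x)))).
have mRR := measurable_pairing (fun s => (gR s).1) (fun s => (gR s).2) kR sR.
have mRI := measurable_pairing (fun s => (gR s).1) (fun s => (gR s).2) kR sI.
have mIR := measurable_pairing (fun s => (gI s).1) (fun s => (gI s).2) kI sR.
have mII := measurable_pairing (fun s => (gI s).1) (fun s => (gI s).2) kI sI.
pose gr s x := Re (g s x); pose gi s x := Im (g s x).
exists (fun p => Complex (pair gr (@complex.Re R) p + pair gi (@complex.Im R) p)
                         (pair gr (@complex.Im R) p - pair gi (@complex.Re R) p)).
  split; first exact: (measurable_funD mRR mII).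
  exact: (measurable_funB mRI mIR).
have T0ae : \forall t \ae muN, T0 t.
  apply: filterS Phi_L2 => t tL; have [fR fI] := integrable_ip hip hH psiL tL.
  rewrite /T0/= (fin_integral (f := fun x => q (t, x))) ?ltry//.
  by apply: RintegrableD; exact: Rintegrable_norm.
apply: filterS (ae_snd (filterI T0ae ae_pairing)) => -[s t] /= [tT ->].
have [iR iI] : Rintegrable muX (fun x => Re (f (t, x))) /\ Rintegrable muX (fun x => Im (f (t, x))).
  split; [have := sR.2 t|have := sI.2 t]; congr Rintegrable;
    by apply/funext => x /=; rewrite indicE mem_set// mul1r.
have pairE k (P : R[i] -> R) : pair k P (s, t) = \int[muX]_x (k s x * P (f (t, x))).
  by apply: eq_Rintegral => x _ /=; rewrite indicE mem_set// mul1r.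
have [[mgR bgR] [mgI bgI]] := (gR s, gI s).
rewrite !pairE -RintegralD//; [|exact: Rintegrable_bounded_mul..].
rewrite -RintegralB//; [|exact: Rintegrable_bounded_mul..].
rewrite /cintegral; congr Complex; apply: eq_Rintegral => x _;
  by rewrite ip_modulation -/(f (t, x)) conjCE mulCE/= /gr /gi; ring.
Qed.
End FrameFibres.

(** * Global and fibrewise frame inequalities *)

Section FrameEquivalence.
Context (R : realType) (dX dM dN : measure_display).
Context (X : measurableType dX) (M : measurableType dM) (N : measurableType dN).
Variables (muX : {sigma_finite_measure set X -> \bar R}).
Variables (muM : {sigma_finite_measure set M -> \bar R}).
Variables (muN : {sigma_finite_measure set N -> \bar R}).
Variable g : M -> X -> R[i].
Hypothesis hg : parseval_determining muX muM g.
Variables (H : normedModType R[i]) (ip : {dot H for Num.conj}).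
Hypothesis hip : norm_induced_by ip.
Hypothesis hH : separable H.
Variables (phi Phi : N -> X -> H).
Hypothesis hphi : forall t, vector_L2 muX ip (phi t).
Hypothesis hPhi : joint_representative muN muX ip phi Phi.
Variable A0 : set (X -> H).
Hypothesis hA0 : A0 `<=` range phi.
Hypothesis hA0_countable : countable A0.
Hypothesis hA0_dense : range phi `<=` L2closure muX ip A0.
Variables (A B : R).
Hypothesis hA : 0 < A.
Hypothesis hAB : A <= B.
Let vL2 := vector_L2 muX ip.
Let S := S_ muX ip (range g) (range phi).
Let energy x := frame_energy muN ip (Phi ^~ x).

Lemma range_phi_L2 : range phi `<=` vL2.
Proof. by move=> _ [t _ <-]; exact: hphi. Qed.

(** Membership in the fibre space passes from [A0] to its L2 closure, then to
    modulations and linear combinations, then to the L2 closure again. *)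
Lemma S_fibre psi : S psi -> \forall x \ae muX, fibre_space A0 x (psi x).
Proof.
have Jclosed x : closed (fibre_space A0 x) by exact: closed_closure.
have phiJ t : \forall x \ae muX, fibre_space A0 x (phi t x).
  apply: (L2closure_fibre hip hH _ Jclosed); last by apply: hA0_dense; exists t.
    by move=> f A0f; apply: range_phi_L2; exact: hA0.
  by move=> f A0f; apply: nearW => x; apply: subset_closure; apply: mem_span; exists f.
apply: (L2closure_fibre hip hH _ Jclosed).
  exact: (span_modulations_L2 hg hip hH range_phi_L2).
move=> _ [n [c [a [Va ->]]]].
have aJ i : \forall x \ae muX, fibre_space A0 x (a i x).
  have [_ [s _ <-] [_ [t _ <-] ->]] := Va i.
  by apply: filterS (phiJ t) => x; exact: closure_spanZ.
have : \forall x \ae muX, forall i, fibre_space A0 x (a i x).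
  have := @filter_forall _ _ (fun i x => fibre_space A0 x (a i x))
    (almost_everywhere muX) _ aJ; exact.
apply: filterS => x ax.
by rewrite fct_sumE; apply: closure_span_sum => i; exact: ax.
Qed.

Definition fibre_frame := \forall x \ae muX, forall u, fibre_space A0 x u ->
  ((A * hnorm u ^+ 2)%:E <= energy x u)%E /\ (energy x u <= (B * hnorm u ^+ 2)%:E)%E.

Definition global_frame := forall psi, S psi ->
  (A%:E * \int[muX]_x (hnorm (psi x) ^+ 2)%:E <= \int[muX]_x energy x (psi x))%E /\
  (\int[muX]_x energy x (psi x) <= B%:E * \int[muX]_x (hnorm (psi x) ^+ 2)%:E)%E.

Let B0 : 0 < B. Proof. exact: lt_le_trans hAB. Qed.

Lemma energy_ge0 x u : (0 <= energy x u)%E.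
Proof. by apply: integral_ge0 => t _; rewrite lee_fin sqr_ge0. Qed.

Lemma energy0 x : energy x 0 = 0%E.
Proof.
by apply: integral0_eq => t _; rewrite linear0l ComplexField.Normc.normc0 expr0n.
Qed.

Let msqr psi : vL2 psi -> measurable_fun setT (fun x => (hnorm (psi x) ^+ 2)%:E).
Proof. by case/(vector_L2P muX hip hH) => _ /measurable_int. Qed.

Let scaled_sqr c psi : 0 <= c -> vL2 psi ->
  (c%:E * \int[muX]_x (hnorm (psi x) ^+ 2)%:E = \int[muX]_x (c * hnorm (psi x) ^+ 2)%:E)%E.
Proof.
move=> c0 psiL; rewrite -ge0_integralZl_EFin//; last exact: msqr.
by move=> x _; rewrite lee_fin sqr_ge0.
Qed.

Lemma global_of_fibre : fibre_frame -> global_frame.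
Proof.
move=> hfib psi Spsi; have psiL : vL2 psi := Spsi.1.
have me := measurable_fibre_energy (muN := muN) hip hH hPhi psiL.
have ms c : measurable_fun setT (fun x => (c * hnorm (psi x) ^+ 2)%:E).
  by apply/measurable_EFinP/measurable_funM => //; exact/measurable_EFinP/msqr.
rewrite !scaled_sqr ?(ltW hA) ?(ltW B0)//; split; apply: ae_ge0_le_integral => //.
- by move=> x _; rewrite lee_fin mulr_ge0 ?sqr_ge0 ?ltW.
- by move=> x _; exact: energy_ge0.
- by apply: filterS (filterI hfib (S_fibre Spsi)) => x [Jx psiJ] _; case: (Jx _ psiJ).
- by move=> x _; exact: energy_ge0.
- by move=> x _; rewrite lee_fin mulr_ge0 ?sqr_ge0 ?ltW.
- by apply: filterS (filterI hfib (S_fibre Spsi)) => x [Jx psiJ] _; case: (Jx _ psiJ).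
Qed.

Lemma restrict_bounded (E : set X) : measurable E ->
  measurable_complex (fun x => (\1_E x)%:C%C : R[i]) /\
  ae_bounded_complex muX (fun x => (\1_E x)%:C%C).
Proof.
move=> mE; split; first by split; [exact: measurable_indic|exact: measurable_cst].
exists 1; apply: nearW => x /=; rewrite expr0n addr0 sqrtr_sqr indicE.
by case: (_ \in _); rewrite ?normr0 ?normr1.
Qed.

(** The functions [\1_E *: w], for all measurable [E], lie in [S]; the global
    inequality for them compares the integrals over [E]. *)
Lemma fibre_of_global_combination (e : nat -> X -> H) l :
  (forall n, A0 (e n)) -> global_frame ->
  \forall x \ae muX, let u := rational_combination e l x in
    ((A * hnorm u ^+ 2)%:E <= energy x u)%E /\ (energy x u <= (B * hnorm u ^+ 2)%:E)%E.
Proof.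
move=> eA hglob; pose w := rational_combination e l.
pose a i := tnth (in_tuple l) i.
have F_e i : range phi (e (a i).1) by exact/hA0/eA.
have wS E : measurable E -> S (fun x => (\1_E x)%:C%C *: w x).
  move=> mE; rewrite (_ : (fun x => _) =
      fun x => \sum_i ((\1_E x)%:C%C * gauss R (a i).2) *: e (a i).1 x); last first.
    apply/funext => x; rewrite /w /rational_combination big_tnth scaler_sumr.
    by apply: eq_bigr => i _; rewrite scalerA.
  have [mI [C IC]] := restrict_bounded mE.
  apply: (bounded_combination_S hg hip hH range_phi_L2) => // i.
    by apply: measurable_complexM => //; exact: measurable_complex_cst.
  exists (C * normc (gauss R (a i).2)); apply: filterS IC => x Ix.
  by rewrite ComplexField.Normc.normcM ler_wpM2r ?normc_ge0.
have wL : vL2 w.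
  have := (wS setT measurableT).1; congr (vL2 _); apply/funext => x.
  by rewrite indicT scale1r.
have me := measurable_fibre_energy (muN := muN) hip hH hPhi wL.
have ms c : measurable_fun setT (fun x => (c * hnorm (w x) ^+ 2)%:E).
  by apply/measurable_EFinP/measurable_funM => //; exact/measurable_EFinP/msqr.
have local E : measurable E ->
    (\int[muX]_(x in E) (A * hnorm (w x) ^+ 2)%:E <= \int[muX]_(x in E) energy x (w x))%E /\
    (\int[muX]_(x in E) energy x (w x) <= \int[muX]_(x in E) (B * hnorm (w x) ^+ 2)%:E)%E.
  move=> mE; have := hglob _ (wS E mE).
  rewrite !scaled_sqr ?(ltW hA) ?(ltW B0)//; [|exact: (wS E mE).1..].
  have sqE c : (\int[muX]_x (c * hnorm ((\1_E x)%:C%C *: w x) ^+ 2)%:E =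
      \int[muX]_(x in E) (c * hnorm (w x) ^+ 2)%:E)%E.
    rewrite [RHS]integral_mkcond; apply: eq_integral => x _; rewrite patchE indicE.
    by case: (_ \in _); rewrite ?scale1r// scale0r hnorm0 expr0n mulr0.
  have energyE : (\int[muX]_x energy x ((\1_E x)%:C%C *: w x) =
      \int[muX]_(x in E) energy x (w x))%E.
    rewrite [RHS]integral_mkcond; apply: eq_integral => x _; rewrite patchE indicE.
    by case: (_ \in _); rewrite ?scale1r// scale0r energy0.
  by rewrite !sqE energyE.
have fin c : 0 <= c -> (\int[muX]_x (c * hnorm (w x) ^+ 2)%:E < +oo)%E.
  move=> c0; rewrite -scaled_sqr// (integral_sqr_hnorm hip hH wL) -EFinM; exact: ltry.
have pos c x : 0 <= c -> (0 <= (c * hnorm (w x) ^+ 2)%:E)%E.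
  by move=> c0; rewrite lee_fin mulr_ge0// sqr_ge0.
have lo : \forall x \ae muX, ((A * hnorm (w x) ^+ 2)%:E <= energy x (w x))%E.
  apply: ae_le_of_integral_le => //.
  - by move=> x; rewrite pos// ltW.
  - by move=> x; exact: energy_ge0.
  - by apply: fin; exact: ltW.
  - by move=> E mE; case: (local E mE).
have up : \forall x \ae muX, (energy x (w x) <= (B * hnorm (w x) ^+ 2)%:E)%E.
  apply: ae_le_of_integral_le => //.
  - by move=> x; exact: energy_ge0.
  - by move=> x; rewrite pos// ltW.
  - by apply: le_lt_trans (local _ measurableT).2 (fin _ (ltW B0)).
  - by move=> E mE; case: (local E mE).
by apply: filterS (filterI lo up) => x.
Qed.

(** The exceptional null sets of the countably many rational combinations add up
    to a null set, and these combinations are dense in every fibre space. *)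
Lemma fibre_of_global : global_frame -> fibre_frame.
Proof.
move=> hglob; case/pfcard_geP: hA0_countable => [A00|[e]].
  apply: nearW => x u; rewrite /fibre_space A00 image_set0.
  move=> /closureP u0; have -> : u = 0.
    apply/eqP; rewrite -normr_eq0 normHE; apply/eqP; congr (_%:C%C).
    apply/eqP; rewrite eq_le hnorm_ge0 andbT; apply/ler_addgt0Pr => r r0; rewrite add0r.
    have [_ [n [c [a [a0 ->]]]] ur] := u0 r r0.
    move: ur; rewrite big1 ?subr0 => [/ltW//|i _]; by have := a0 i.
  by rewrite hnorm0 expr0n !mulr0 energy0.
have eA n : A0 (e n) by exact: funS.
have erange x : [set f x | f in A0] = range (fun n => e n x).
  apply/seteqP; split=> [_ [f A0f <-]|_ [n _ <-]]; last by exists (e n).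
  have /(_ f A0f)[n _ <-] : set_surj setT A0 e by exact: surj.
  by exists n.
pose good x l := let u := rational_combination e l x in
    ((A * hnorm u ^+ 2)%:E <= energy x u)%E /\ (energy x u <= (B * hnorm u ^+ 2)%:E)%E.
pose enum n : seq (nat * (rat * rat)) := odflt [::] (choice.unpickle n).
have : \forall x \ae muX, forall n, good x (enum n).
  by apply: ae_foralln => n; exact: fibre_of_global_combination.
apply: filterS => x allgood.
have goodx l : good x l by have := allgood (choice.pickle l); rewrite /enum choice.pickleK.
apply: (@frame_inequality_closure _ _ _ muN _ _ hip _ (weakly_measurable_Phi_r hPhi x)
  (range (rational_combination e ^~ x))) => //.
- move=> _ [l _ <-]; apply: subset_closure; rewrite erange.
  exact: rational_combination_span.
- by rewrite /fibre_space erange; exact: rational_combination_dense.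
- by move=> u v; exact: closure_spanB.
- by move=> _ [l _ <-]; exact: goodx.
Qed.

End FrameEquivalence.

Theorem theorem2p10 (R : realType) (dX dM dN : measure_display)
  (X : measurableType dX) (M : measurableType dM) (N : measurableType dN)
  (muX : {sigma_finite_measure set X -> \bar R})
  (muM : {sigma_finite_measure set M -> \bar R})
  (muN : {sigma_finite_measure set N -> \bar R})
  (g : M -> X -> R[i]) (hg : parseval_determining muX muM g)
  (H : completeNormedModType R[i]) (ip : {dot H for Num.conj})
  (hip : norm_induced_by ip) (hH : separable H)
  (phi Phi : N -> X -> H)
  (hphi : forall t, vector_L2 muX ip (phi t))
  (hPhi : joint_representative muN muX ip phi Phi)
  (A0 : set (X -> H)) (hA0 : A0 `<=` range phi) (hA0_countable : countable A0)
  (hA0_dense : range phi `<=` L2closure muX ip A0)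
  (A B : R) (hA : 0 < A) (hAB : A <= B) :
  [<->
    continuous_frame (muM \x muN)%E (S_ muX ip (range g) (range phi))
      (L2inner muX ip) A B (fun st x => g st.1 x *: phi st.2 x);

    forall psi, S_ muX ip (range g) (range phi) psi ->
      (A%:E * \int[muX]_x (hnorm (psi x) ^+ 2)%:E <=
       \int[muN]_t \int[muM]_s
         (normc
           (cintegral muX (fun x => ip (psi x) (g s x *: Phi t x))) ^+ 2)%:E)%E /\
      (\int[muN]_t \int[muM]_s
         (normc
           (cintegral muX (fun x => ip (psi x) (g s x *: Phi t x))) ^+ 2)%:E <=
       B%:E * \int[muX]_x (hnorm (psi x) ^+ 2)%:E)%E;

    \forall x \ae muX, forall u, fibre_space A0 x u ->
      ((A * hnorm u ^+ 2)%:E <=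
       \int[muN]_t (normc (ip u (Phi t x)) ^+ 2)%:E)%E /\
      (\int[muN]_t (normc (ip u (Phi t x)) ^+ 2)%:E <=
       (B * hnorm u ^+ 2)%:E)%E ].
Proof.
have sq c psi : vector_L2 muX ip psi ->
    (c * complex.Re (L2inner muX ip psi psi))%:E =
    (c%:E * \int[muX]_x (hnorm (psi x) ^+ 2)%:E)%E.
  move=> psiL; rewrite (integral_sqr_hnorm hip hH psiL) -EFinM; congr (_ * _)%:E.
  exact: rdot_sqL2.
have iter := iterated_energy hg hip hH hphi hPhi.
tfae.
- move=> [_ frame] psi Spsi; have psiL := Spsi.1.
  have [mpsi] := frame psi Spsi.
  by rewrite iter// (product_energy hg hip hH hphi hPhi psiL mpsi) !sq.
- move=> iterated; apply: (fibre_of_global hg hip hH hphi hPhi hA0 hA0_countable hA hAB).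
  by move=> psi Spsi; rewrite -iter; [exact: iterated|exact: Spsi.1].
- move=> hfib; split=> [[s t]|psi Spsi] /=.
    have [mgs bgs] := Linfty_bounded (hg.1 s).
    have -> : (fun x => g s x *: phi t x) = (fun x => \sum_(i < 1) g s x *: phi t x).
      by apply/funext => x; rewrite big_ord1.
    by apply: (bounded_combination_S hg hip hH (range_phi_L2 hphi)
      (k := fun=> g s) (phi := fun=> phi t)).
  have psiL := Spsi.1.
  have mpsi := ae_measurable_pairing hg hip hH hphi hPhi psiL.
  have [lo up] := global_of_fibre hg hip hH hphi hPhi hA0 hA0_dense hA hAB hfib Spsi.
  by split=> //; rewrite (product_energy hg hip hH hphi hPhi psiL mpsi) sq.
Qed.
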